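(* There exists a trigonometric series $\sum_{n=-\infty}^{\infty} c(n)e^{int}$ on the circle $\mathbb{T}=\mathbb{R}/2\pi\mathbb{Z}$, with not all $c(n)$ equal to zero, whose symmetric partial sums $\sum_{|n|\le N} c(n)e^{int}$ converge to $0$ as $N\to\infty$ for almost every $t\in\mathbb{T}$, and whose coefficients with negative index satisfy, for every $k=1,2,\dots$, $c(n)=O(|n|^{-k})$ as $n\to-\infty$.
   Context: A trigonometric series $\sum_{n\in\mathbb{Z}} c(n)e^{int}$ is called a null-series if its symmetric partial sums converge to zero almost everywhere on $\mathbb{T}$. The series is nontrivial if some $c(n)\neq 0$. *)

(* Defs.v *)
From mathcomp Require Import all_boot all_order all_algebra.
From mathcomp Require Import all_classical all_reals all_analysis.
From mathcomp Require Export complex.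
Import Order.TTheory GRing.Theory Num.Theory numFieldNormedType.Exports.
Local Open Scope classical_set_scope.
Local Open Scope ring_scope.

Definition expint {R : realType} (n : int) (t : R) : R[i] :=
  Complex (cos (n%:~R * t)) (sin (n%:~R * t)).

Definition sym_partial_sum {R : realType} (c : int -> R[i]) (N : nat) (t : R) : R[i] :=
  \sum_(0 <= k < (N.*2).+1) c (k%:Z - N%:Z) * expint (k%:Z - N%:Z) t.

Definition sym_partial_sums_to0 {R : realType} (c : int -> R[i]) (t : R) : Prop :=
  ((fun N => complex.Re (sym_partial_sum c N t)) @ \oo --> 0) /\
  ((fun N => complex.Im (sym_partial_sum c N t)) @ \oo --> 0).

(* Main.v *)
(* The coefficients are those of a distribution [T] supported on a null set:
   [T] is the limit of [D_j], where [D_0] is a smooth bump supported in [1, 2]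
   and [D_(j+1) = D_j * (1 - e^(i s))^l * X(s)] with [s = 16^l t^2 + be]; here
   [X] vanishes for [s] close to [2 pi Z] and equals 1 outside a slightly
   larger neighbourhood, and [l] is taken very large at each step.

   - Since [|1 - e^(i s)|^l] is tiny where [X <> 1], replacing [X] by 1 costs an
     error small in [C^k]; then [D_(j+1) - D_j] is a combination of the functions
     [D_j e^(i m s)], [m >= 1], whose phase is not stationary against [e^(i nu t)]
     for [nu >= 0].  Hence the coefficients of negative index decay fast; [k]
     grows slowly with [j].
   - The phase [16^l t^2] is curved, so all coefficients of [D_(j+1) - D_j] are
     [O(2^l 4^(-l))] by van der Corput, and this survives multiplication by a
     fixed [C^1] weight.
   - Choosing [be] by pigeonhole, each step kills a definite proportion of the
     set where [D_j] is alive; these proportions have divergent sum, so almost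
     every [t0] is eventually dead.
   - If [D_j] vanishes near [t0] for large [j], then [T = (e^(i (t - t0)) - 1) Q]
     with [Q] a distribution whose coefficients tend to 0 for the same reason,
     and the symmetric partial sums of [T] at [t0] telescope to two coefficients
     of [Q]. *)

Require Import Defs.
From mathcomp Require Import all_boot all_order all_algebra.
From mathcomp Require Import all_classical all_reals all_analysis.
From mathcomp Require Import complex.
From mathcomp Require Import measurable_realfun.
From mathcomp Require Import ring lra zify.
Import Order.TTheory GRing.Theory Num.Theory numFieldNormedType.Exports.
Local Open Scope classical_set_scope.
Local Open Scope ring_scope.
Local Open Scope complex_scope.
Set Implicit Arguments.
Unset Strict Implicit.
Unset Printing Implicit Defensive.

(** * Moduli, componentwise derivatives and continuity of complex-valued functions of a real
    variable *)

Section ComplexFunctions.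
Context {R : realType}.
Implicit Types (f g : R -> R[i]) (z w : R[i]) (t : R).

Notation normc := (@Normc.normc R).
Notation Re := (@complex.Re R).
Notation Im := (@complex.Im R).

Lemma normc_ge0 z : 0 <= normc z.
Proof. by case: z => a b; exact: sqrtr_ge0. Qed.

Lemma ler_normcD z w : normc (z + w) <= normc z + normc w.
Proof. exact: le_normcD. Qed.

Lemma normcN z : normc (- z) = normc z.
Proof. by case: z => a b /=; rewrite !sqrrN. Qed.

Lemma ler_normcB z w : normc (z - w) <= normc z + normc w.
Proof. by rewrite -(normcN w) ler_normcD. Qed.

Lemma normc_real (x : R) : normc x%:C = `|x|.
Proof. by rewrite /= expr0n /= addr0 sqrtr_sqr. Qed.

Lemma normc_i : normc 'i = 1.
Proof. by rewrite /= expr0n /= add0r expr1n sqrtr1. Qed.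

Lemma normcX z n : normc (z ^+ n) = normc z ^+ n.
Proof. by elim: n => [|n IH]; rewrite ?Normc.normc1 // !exprS Normc.normcM IH. Qed.

Lemma ler_normc_sum (I : Type) (r : seq I) (P : pred I) (F : I -> R[i]) :
  normc (\sum_(i <- r | P i) F i) <= \sum_(i <- r | P i) normc (F i).
Proof.
elim/big_ind2 : _ => [|z1 x1 z2 x2 H1 H2|//]; first by rewrite Normc.normc0.
by apply: le_trans (ler_normcD _ _) _; exact: lerD.
Qed.

Lemma normr_Re_le z : `|Re z| <= normc z.
Proof. by case: z => a b /=; rewrite -sqrtr_sqr ler_wsqrtr // lerDl sqr_ge0. Qed.

Lemma normr_Im_le z : `|Im z| <= normc z.
Proof. by case: z => a b /=; rewrite -sqrtr_sqr ler_wsqrtr // lerDr sqr_ge0. Qed.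

Lemma normc_le_ReIm z : normc z <= `|Re z| + `|Im z|.
Proof.
have -> : z = (Re z)%:C + 'i * (Im z)%:C by rewrite -complexE.
rewrite (le_trans (ler_normcD _ _)) // Normc.normcM normc_i mul1r !normc_real.
by case: z => a b /=; rewrite !(mul0r, mul1r, mulr0, subr0, add0r, addr0).
Qed.

Lemma ReD z w : Re (z + w) = Re z + Re w. Proof. by case: z; case: w. Qed.
Lemma ImD z w : Im (z + w) = Im z + Im w. Proof. by case: z; case: w. Qed.
Lemma ReM z w : Re (z * w) = Re z * Re w - Im z * Im w.
Proof. by case: z; case: w. Qed.
Lemma ImM z w : Im (z * w) = Re z * Im w + Im z * Re w.
Proof. by case: z => a b; case: w. Qed.

Lemma complex_ext z w : Re z = Re w -> Im z = Im w -> z = w.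
Proof. by case: z => a b; case: w => c d /= -> ->. Qed.

Definition cis (x : R) : R[i] := Complex (cos x) (sin x).

Lemma normc_cis x : normc (cis x) = 1.
Proof. by rewrite /= cos2Dsin2 sqrtr1. Qed.

Lemma cis0 : cis 0 = 1.
Proof. by rewrite /cis cos0 sin0. Qed.

Lemma cisD x y : cis (x + y) = cis x * cis y.
Proof.
by apply: complex_ext; rewrite ?ReM ?ImM /= ?cosD ?sinD // addrC.
Qed.

Lemma cisX x n : cis x ^+ n = cis (n%:R * x).
Proof.
elim: n => [|n IH]; first by rewrite mul0r cis0.
by rewrite exprS IH -cisD; congr cis; rewrite -natr1; ring.
Qed.

Definition cder f t v := is_derive t (1 : R) (fun x => Re (f x)) (Re v) /\
  is_derive t (1 : R) (fun x => Im (f x)) (Im v).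

Definition ccont f t := continuous_at t (fun x => Re (f x)) /\
  continuous_at t (fun x => Im (f x)).

Lemma is_derive_cont (u : R -> R) t du : is_derive t (1 : R) u du ->
  continuous_at t u.
Proof. by move=> H; apply/differentiable_continuous/derivable1_diffP. Qed.

Lemma cont_atM (u v : R -> R) t : continuous_at t u -> continuous_at t v ->
  continuous_at t (fun x => u x * v x).
Proof. exact: continuousM. Qed.

Lemma cont_atD (u v : R -> R) t : continuous_at t u -> continuous_at t v ->
  continuous_at t (fun x => u x + v x).
Proof. exact: continuousD. Qed.

Lemma cont_at_cst (a : R) t : continuous_at t (fun=> a).
Proof. exact: cst_continuous. Qed.

Lemma cont_at_id t : continuous_at t (fun x : R => x).
Proof. exact: cvg_id. Qed.

Lemma cder_cont f t v : cder f t v -> ccont f t.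
Proof. by case=> H1 H2; split; apply: is_derive_cont; eassumption. Qed.

Lemma cder_eq f t v w : cder f t v -> v = w -> cder f t w.
Proof. by move=> H <-. Qed.

Lemma cder_cst z t : cder (fun=> z) t 0.
Proof. by split; exact: is_derive_cst. Qed.

Lemma cderD f g t v w : cder f t v -> cder g t w ->
  cder (fun x => f x + g x) t (v + w).
Proof.
move=> [f1 f2] [g1 g2]; split.
  rewrite ReD; under eq_fun do rewrite ReD; exact: is_deriveD.
rewrite ImD; under eq_fun do rewrite ImD; exact: is_deriveD.
Qed.

Lemma cderM f g t v w : cder f t v -> cder g t w ->
  cder (fun x => f x * g x) t (v * g t + f t * w).
Proof.
move=> [f1 f2] [g1 g2]; split.
  under eq_fun do rewrite ReM.
  have := is_deriveB (is_deriveM f1 g1) (is_deriveM f2 g2).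
  move=> H; apply: (is_derive_eq H).
  by rewrite /GRing.scale /= ReD !ReM; ring.
under eq_fun do rewrite ImM.
have := is_deriveD (is_deriveM f1 g2) (is_deriveM f2 g1).
move=> H; apply: (is_derive_eq H).
by rewrite /GRing.scale /= ImD !ImM; ring.
Qed.

Lemma cder_real (u : R -> R) t du : is_derive t (1 : R) u du ->
  cder (fun x => (u x)%:C) t du%:C.
Proof. by move=> H; split => //=; exact: is_derive_cst. Qed.

Lemma cder_cis (u : R -> R) t du : is_derive t (1 : R) u du ->
  cder (fun x => cis (u x)) t ('i * du%:C * cis (u t)).
Proof.
move=> H; split.
  have := is_derive1_comp (is_derive_cos (u t)) H.
  move=> H1; apply: (is_derive_eq H1).
  by rewrite !ReM !ImM /=; ring.
have := is_derive1_comp (is_derive_sin (u t)) H.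
move=> H1; apply: (is_derive_eq H1).
by rewrite !ImM !ReM /=; ring.
Qed.

Lemma ccont_cst z t : ccont (fun=> z) t.
Proof. exact: cder_cont (cder_cst z t). Qed.

Lemma ccontD f g t : ccont f t -> ccont g t -> ccont (fun x => f x + g x) t.
Proof.
move=> [f1 f2] [g1 g2]; split.
  under eq_fun do rewrite ReD; exact: continuousD f1 g1.
under eq_fun do rewrite ImD; exact: continuousD f2 g2.
Qed.

Lemma ccontM f g t : ccont f t -> ccont g t -> ccont (fun x => f x * g x) t.
Proof.
move=> [f1 f2] [g1 g2]; split.
  under eq_fun do rewrite ReM.
  exact: continuousB (continuousM f1 g1) (continuousM f2 g2).
under eq_fun do rewrite ImM.
exact: continuousD (continuousM f1 g2) (continuousM f2 g1).
Qed.

Lemma ccont_sum n (F : nat -> R -> R[i]) t : (forall i, ccont (F i) t) ->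
  ccont (fun x => \sum_(0 <= i < n) F i x) t.
Proof.
move=> hF; elim: n => [|n IH].
  have -> : (fun x => \sum_(0 <= i < 0) F i x) = (fun=> 0).
    by apply/funext => x; rewrite big_nil.
  exact: ccont_cst.
have -> : (fun x => \sum_(0 <= i < n.+1) F i x) =
  (fun x => \sum_(0 <= i < n) F i x + F n x).
  by apply/funext => x; rewrite big_nat_recr.
by apply: ccontD.
Qed.

Lemma ccont_comp f (u : R -> R) t : continuous_at t u -> ccont f (u t) ->
  ccont (f \o u) t.
Proof.
by move=> hu [f1 f2]; split; [exact: continuous_comp hu f1|exact: continuous_comp hu f2].
Qed.

Lemma cder_comp f (u : R -> R) t du v : is_derive t (1 : R) u du ->
  cder f (u t) v -> cder (f \o u) t (v * du%:C).
Proof.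
move=> hu [f1 f2]; split.
  have := is_derive1_comp f1 hu; move=> H; apply: (is_derive_eq H).
  by rewrite ReM /=; ring.
have := is_derive1_comp f2 hu; move=> H; apply: (is_derive_eq H).
by rewrite ImM /=; ring.
Qed.

End ComplexFunctions.

(** * Scaled [C^k] bounds and their calculus *)

Section ScaledBounds.
Context {R : realType}.
Implicit Types (f g : R -> R[i]) (t r C : R) (D : set R) (b : bool).

Notation normc := (@Normc.normc R).

(* On [D], the derivatives of [f] of order [i <= k] exist and are bounded by
   [C * r ^+ i]; when [b] holds they all vanish at [1] and [2]. *)
Fixpoint Cbound D b (k : nat) r C f {struct k} : Prop :=
  [/\ forall t, D t -> normc (f t) <= C,
      b -> f 1 = 0 /\ f 2 = 0 &
      match k with
      | 0 => forall t, D t -> ccont f t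
      | k'.+1 => exists f', (forall t, D t -> cder f t (f' t)) /\
                            Cbound D b k' r (C * r) f'
      end].

Lemma Cbound_le_norm D b k r C f t : Cbound D b k r C f -> D t -> normc (f t) <= C.
Proof. by case: k => [|k] [H _ _]; exact: H. Qed.

Lemma Cbound_cont D b k r C f t : Cbound D b k r C f -> D t -> ccont f t.
Proof.
case: k => [|k] [_ _ H] Dt; first exact: H.
by case: H => f' [H _]; exact: cder_cont (H t Dt).
Qed.

Lemma Cbound_le D b k r r' C C' f : 0 <= r -> r <= r' -> 0 <= C -> C <= C' ->
  Cbound D b k r C f -> Cbound D b k r' C' f.
Proof.
move=> r0 rr'; elim: k C C' f => [|k IH] C C' f C0 CC' [H1 H2 H3]; split => //.
- by move=> t /H1 /le_trans; exact.
- by move=> t /H1 /le_trans; exact.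
- case: H3 => f' [H3 H4]; exists f'; split=> //.
  by apply: IH H4; [exact: mulr_ge0|exact: ler_pM].
Qed.

Lemma Cbound_pred D b k r C f : Cbound D b k.+1 r C f -> Cbound D b k r C f.
Proof.
elim: k C f => [|k IH] C f [H1 H2 [f' [H3 H4]]]; split => //.
  by move=> t Dt; exact: cder_cont (H3 t Dt).
by exists f'; split => //; exact: IH.
Qed.

Lemma Cbound_zero D b k r C : 0 <= r -> 0 <= C -> Cbound D b k r C (fun=> 0).
Proof.
move=> r0; elim: k C => [|k IH] C C0; split => //;
  try (by move=> t _; rewrite Normc.normc0).
  by move=> t _; exact: ccont_cst.
by exists (fun=> 0); split; [move=> t _; exact: cder_cst|apply: IH; exact: mulr_ge0].
Qed.

Lemma Cbound_cst D k r C z : 0 <= r -> normc z <= C ->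
  Cbound D false k r C (fun=> z).
Proof.
move=> r0 zC; case: k => [|k]; split => //; first by move=> t _; exact: ccont_cst.
exists (fun=> 0); split; first by move=> t _; exact: cder_cst.
by apply: Cbound_zero => //; apply: mulr_ge0 => //; exact: le_trans (normc_ge0 z) zC.
Qed.

Lemma CboundD D b k r C1 C2 f g : Cbound D b k r C1 f -> Cbound D b k r C2 g ->
  Cbound D b k r (C1 + C2) (fun x => f x + g x).
Proof.
elim: k C1 C2 f g => [|k IH] C1 C2 f g [f1 f2 f3] [g1 g2 g3]; split.
- by move=> t Dt; apply: le_trans (ler_normcD _ _) _; apply: lerD; [exact: f1|exact: g1].
- by move=> bt; case: (f2 bt) => -> ->; case: (g2 bt) => -> ->; rewrite addr0.
- by move=> t Dt; apply: ccontD; [exact: f3|exact: g3].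
- by move=> t Dt; apply: le_trans (ler_normcD _ _) _; apply: lerD; [exact: f1|exact: g1].
- by move=> bt; case: (f2 bt) => -> ->; case: (g2 bt) => -> ->; rewrite addr0.
- case: f3 => f' [f3 f4]; case: g3 => g' [g3 g4].
  exists (fun x => f' x + g' x); split.
    by move=> t Dt; apply: cderD; [exact: f3|exact: g3].
  by rewrite mulrDl; exact: IH.
Qed.

(** Leibniz rule: each differentiation turns one product into two, at the cost of a factor 2 per
    order. The vanishing at the endpoints is inherited from [f] alone. *)
Lemma CboundM D b k r C1 C2 f g : 0 <= r -> 0 <= C1 -> 0 <= C2 ->
  Cbound D b k r C1 f -> Cbound D false k r C2 g ->
  Cbound D b k r (2 ^+ k * C1 * C2) (fun x => f x * g x).
Proof.
move=> r0; elim: k C1 C2 f g => [|k IH] C1 C2 f g C10 C20 Hf Hg.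
  case: Hf => [f1 f2 f3]; case: Hg => [g1 g2 g3]; split.
  - move=> t Dt; rewrite expr0 mul1r Normc.normcM.
    by apply: ler_pM; rewrite ?normc_ge0//; [exact: f1|exact: g1].
  - by move=> bt; case: (f2 bt) => -> ->; rewrite !mul0r.
  - by move=> t Dt; apply: ccontM; [exact: f3|exact: g3].
have Hf' := Cbound_pred Hf; have Hg' := Cbound_pred Hg.
case: Hf => [f1 f2 [f' [f3 f4]]]; case: Hg => [g1 g2 [g' [g3 g4]]]; split.
- move=> t Dt; rewrite Normc.normcM.
  apply: (@le_trans _ _ (1 * (C1 * C2))).
    by rewrite mul1r; apply: ler_pM; rewrite ?normc_ge0//; [exact: f1|exact: g1].
  by rewrite -mulrA; apply: ler_pM; rewrite ?mulr_ge0// exprn_ege1// ler1n.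
- by move=> bt; case: (f2 bt) => -> ->; rewrite !mul0r.
- exists (fun x => f' x * g x + f x * g' x); split.
    by move=> t Dt; apply: cderM; [exact: f3|exact: g3].
  have -> : 2 ^+ k.+1 * C1 * C2 * r =
      2 ^+ k * (C1 * r) * C2 + 2 ^+ k * C1 * (C2 * r) by rewrite exprS; ring.
  by apply: CboundD; apply: IH => //; exact: mulr_ge0.
Qed.

Lemma CboundZ D b k r C z f : Cbound D b k r C f ->
  Cbound D b k r (normc z * C) (fun x => z * f x).
Proof.
elim: k C f => [|k IH] C f [f1 f2 f3]; split.
- by move=> t Dt; rewrite Normc.normcM ler_wpM2l ?normc_ge0 ?f1.
- by move=> bt; case: (f2 bt) => -> ->; rewrite !mulr0.
- by move=> t Dt; apply: ccontM; [exact: ccont_cst|exact: f3].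
- by move=> t Dt; rewrite Normc.normcM ler_wpM2l ?normc_ge0 ?f1.
- by move=> bt; case: (f2 bt) => -> ->; rewrite !mulr0.
- case: f3 => f' [f3 f4]; exists (fun x => z * f' x); split.
    move=> t Dt; apply: cder_eq (cderM (cder_cst z t) (f3 t Dt)) _.
    by rewrite mul0r add0r.
  by rewrite -mulrA; exact: IH.
Qed.

(** From order 1 on, [C * r ^+ i] is at most [e * (r * B) ^+ i], so a small supremum [e] can replace
    [C] at the price of a larger scale. This keeps a high power small together with its
    derivatives. *)
Lemma Cbound_small D b k r B C e f : 0 <= r -> 1 <= B -> 0 <= C -> 0 <= e ->
  C <= e * B -> (forall t, D t -> normc (f t) <= e) ->
  Cbound D b k r C f -> Cbound D b k (r * B) e f.
Proof.
move=> r0 B1 C0 e0 CeB fe; case: k => [|k] [f1 f2 f3]; split => //.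
case: f3 => f' [f3 f4]; exists f'; split => //.
apply: Cbound_le f4 => //; first by rewrite ler_peMr.
  exact: mulr_ge0.
by rewrite [r * B]mulrC mulrA ler_wpM2r.
Qed.

(** The scale does not grow with [m]. In the application to [remainder], the exponential loss
    [2 ^+ (k * m)] is absorbed by the smallness of [C]. *)
Lemma CboundX D k r C f m : 0 <= r -> 0 <= C -> Cbound D false k r C f ->
  Cbound D false k r ((2 ^+ k * C) ^+ m) (fun x => f x ^+ m).
Proof.
move=> r0 C0 Hf; elim: m => [|m IH].
  by rewrite expr0; apply: Cbound_cst => //; rewrite Normc.normc1.
rewrite exprS; under eq_fun do rewrite exprS.
by apply: CboundM => //; rewrite exprn_ge0// mulr_ge0// exprn_ge0.
Qed.

Lemma Cbound_Re D k r C f : Cbound D false k r C f ->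
  Cbound D false k r C (fun x => (complex.Re (f x))%:C).
Proof.
elim: k C f => [|k IH] C v.
  case=> [v1 v2 v3]; split=> //.
    by move=> t Dt; rewrite normc_real; apply: le_trans (normr_Re_le _) _; exact: v1.
  by move=> t Dt; split; [exact: (v3 t Dt).1|exact: (ccont_cst 0 t).1].
case=> [v1 v2 [v' [v3 v4]]]; split=> //.
  by move=> t Dt; rewrite normc_real; apply: le_trans (normr_Re_le _) _; exact: v1.
exists (fun x => (complex.Re (v' x))%:C); split; last exact: IH.
by move=> t Dt; apply: cder_real; exact: (v3 t Dt).1.
Qed.

(** Chain rule, by induction on [k]: the factor [2 ^+ k * Cu] produced by multiplying with [u'] goes
    into the scale, so the constant [C] survives. *)
Lemma Cbound_comp D k r C Cu f (u : R -> R) : 0 <= r -> 0 <= C -> 0 <= Cu ->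
  Cbound setT false k 1 C f -> Cbound D false k r Cu (fun x => (u x)%:C) ->
  Cbound D false k (r * (1 + 2 ^+ k * Cu)) C (f \o u).
Proof.
move=> r0 C0 Cu0; elim: k f => [|k IH] f Hf Hu.
  case: Hf => [f1 f2 f3]; case: Hu => [u1 u2 u3]; split => //.
    by move=> t _; exact: f1.
  by move=> t Dt; apply: ccont_comp; [exact: (u3 t Dt).1|exact: f3].
have Hu' := Cbound_pred Hu.
case: Hf => [f1 f2 [f' [f3 f4]]]; case: Hu => [u1 u2 [u' [u3 u4]]]; split => //.
  by move=> t _; exact: f1.
exists (fun x => f' (u x) * (complex.Re (u' x))%:C); split.
  by move=> t Dt; apply: cder_comp; [exact: (u3 t Dt).1|exact: f3].
rewrite mulr1 in f4; have := IH _ f4 Hu' => {}f4.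
set B := 1 + 2 ^+ k * Cu in f4; have B1 : 1 <= B.
  by rewrite lerDl mulr_ge0 ?exprn_ge0.
have B0 : 0 <= B by rewrite (le_trans _ B1).
have u5 : Cbound D false k (r * B) (Cu * r) (fun x => (complex.Re (u' x))%:C).
  apply: Cbound_le (Cbound_Re u4) => //; last exact: mulr_ge0.
  by rewrite ler_peMr.
have rB0 : 0 <= r * B by exact: mulr_ge0.
have CB : Cbound D false k (r * B) (2 ^+ k * C * (Cu * r))
    (fun x => f' (u x) * (complex.Re (u' x))%:C).
  exact: (CboundM rB0 C0 (mulr_ge0 Cu0 r0) f4 u5).
apply: Cbound_le CB => //.
- rewrite ler_wpM2l// lerD2l ler_wpM2r// ler_weXn2l// ?ler1n//.
- by rewrite !mulr_ge0// exprn_ge0.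
- have H2 : (2:R) ^+ k.+1 = 2 ^+ k + 2 ^+ k by rewrite exprS; ring.
  have p0 : 0 <= (2:R) ^+ k by exact: exprn_ge0.
  have -> : 2 ^+ k * C * (Cu * r) = C * (r * (2 ^+ k * Cu)) by ring.
  rewrite ler_wpM2l// ler_wpM2l// H2 mulrDl addrA.
  by rewrite -[leLHS]add0r lerD// addr_ge0// mulr_ge0.
Qed.

End ScaledBounds.

(** * Smooth cutoffs and bumps built from e^(-1/x) *)

Section SmoothCutoffs.
Context {R : realType}.
Implicit Types (x t : R) (m k : nat).

Notation normc := (@Normc.normc R).

(** The functions x^(-m) e^(-1/x), extended by 0, carry the index [m] because their span is closed
    under differentiation: all orders then follow by one induction. *)
Definition flat m x : R := if 0 < x then x^-1 ^+ m * expR (- x^-1) else 0.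

Lemma flat_le0 m x : x <= 0 -> flat m x = 0.
Proof. by rewrite /flat leNgt => /negbTE ->. Qed.

Lemma flat_gt0 m x : 0 < x -> 0 < flat m x.
Proof. by move=> x0; rewrite /flat x0 mulr_gt0 ?exprn_gt0 ?invr_gt0 ?expR_gt0. Qed.

Lemma flat_ge0 m x : 0 <= flat m x.
Proof. by case: (ltP 0 x) => [/(flat_gt0 m)/ltW//|/(flat_le0 m) ->]. Qed.

(** With y = 1/x this is y^m / m! <= e^y. *)
Lemma flat_bound m x : flat m x <= m`!%:R.
Proof.
case: (ltP 0 x) => [x0|/(flat_le0 m) -> //].
rewrite /flat x0; set y := x^-1.
have y0 : 0 <= y by rewrite invr_ge0 ltW.
rewrite expRN ler_pdivrMr ?expR_gt0//.
case: m => [|m]; first by rewrite expr0 fact0 mul1r -expR0 ler_expR.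
have := expR_ge1Dxn m y0; move: (expR y) => e He.
rewrite mulrC -ler_pdivrMr ?ltr0n ?fact_gt0//.
by apply: le_trans He; rewrite lerDr.
Qed.

Lemma flatS m x : flat m x = flat m.+1 x * x.
Proof.
rewrite /flat; case: ltP => [x0|]; last by rewrite mul0r.
by rewrite exprSr; field; rewrite gt_eqF.
Qed.

Lemma flat_cont0 m : continuous_at 0 (flat m).
Proof.
apply/cvgrPdist_le => e e0; rewrite [flat m 0]flat_le0//.
near=> x; rewrite sub0r normrN flatS normrM.
apply: (@le_trans _ _ (m.+1`!%:R * (e / m.+1`!%:R))); last first.
  by rewrite mulrC divfK// pnatr_eq0 -lt0n fact_gt0.
apply: ler_pM => //; first by rewrite ger0_norm ?flat_ge0 ?flat_bound.
near: x; apply/nbhs_ballP; exists (e / m.+1`!%:R) => /=.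
  by rewrite divr_gt0// ltr0n fact_gt0.
by move=> y; rewrite /ball /= sub0r normrN => /ltW.
Unshelve. all: by end_near. Qed.

Lemma is_derive_flat m x :
  is_derive x 1 (flat m) (flat m.+2 x - m%:R * flat m.+1 x).
Proof.
case: (ltgtP x 0) => [x0|x0|->].
- rewrite !flat_le0 ?ltW// mulr0 subr0.
  have H0 : is_derive x (1 : R) (cst (0 : R)) 0 by exact: is_derive_cst.
  apply: near_eq_is_derive H0.
  near=> y; have y0 : y < 0 by near: y; exact: lt_nbhsl.
  by rewrite flat_le0// ltW.
- have H1 : is_derive x 1 (fun y : R => y^-1) (- x ^- 2 *: 1).
    by apply: is_deriveV => //; rewrite gt_eqF.
  have HN : is_derive x 1 (fun y : R => - y^-1) (- (- x ^- 2 *: 1)).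
    exact: is_deriveN.
  have H2 := @is_derive1_comp _ expR (fun y => - y^-1) _ _ _ (is_derive_expR _) HN.
  have H3 := is_deriveM (is_deriveX m H1) H2.
  have H4 := near_eq_is_derive _ H3; apply: (is_derive_eq (H4 _ _)).
    near=> y; have y0 : 0 < y by near: y; exact: lt_nbhsr.
    by rewrite /flat y0 !fctE.
  rewrite /flat x0 /= !fctE /GRing.scale /= !mulr1.
  case: m {H3 H4} => [|m]; first by rewrite !expr0 expr1 exprVn; ring.
  rewrite -exprVn /=; move: (x^-1) => y; rewrite -natr1 !exprS; ring.
(* At 0 the slope function in Caratheodory's criterion is [flat m.+1], by [flatS]; it is continuous
   there with value 0. *)
- rewrite !flat_le0// mulr0 subr0; apply/is_derive1_caratheodory.
  exists (flat m.+1); split; last exact: flat_le0.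
    by move=> z; rewrite [flat m 0]flat_le0// !subr0 flatS.
  exact: flat_cont0.
Unshelve. all: by end_near. Qed.

Lemma Cbound_flat k m :
  exists2 C : R, 0 <= C & Cbound setT false k 1 C (fun x => (flat m x)%:C).
Proof.
have H0 j t : normc (flat j t)%:C <= j`!%:R.
  by rewrite normc_real ger0_norm ?flat_ge0 ?flat_bound.
elim: k m => [|k IH] m.
  exists m`!%:R => //; split=> // t _.
  exact: cder_cont (cder_real (is_derive_flat m t)).
have [C1 C10 H1] := IH m.+1; have [C2 C20 H2] := IH m.+2.
exists (m`!%:R + (C2 + m%:R * C1)); first by rewrite !addr_ge0// mulr_ge0.
split=> //.
  by move=> t _; apply: le_trans (H0 _ _) _; rewrite lerDl addr_ge0// mulr_ge0.
exists (fun x => (flat m.+2 x)%:C + (- m%:R%:C) * (flat m.+1 x)%:C); split.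
  move=> t _; apply: cder_eq (cder_real (is_derive_flat m t)) _.
  by apply: complex_ext; rewrite ?ReD ?ImD ?ReM ?ImM /=; ring.
have H3 := CboundD H2 (CboundZ (- m%:R%:C) H1).
rewrite normcN normc_real ger0_norm// in H3.
by apply: Cbound_le H3; rewrite ?mulr1 ?lerDr ?addr_ge0 ?mulr_ge0.
Qed.

Lemma Cbound_unscale (D : set R) b k r C f : 1 <= r -> 0 <= C ->
  Cbound D b k r C f -> Cbound D b k 1 (C * r ^+ k) f.
Proof.
move=> r1; elim: k C f => [|k IH] C f C0 [f1 f2 f3].
  by rewrite expr0 mulr1; split.
split=> //.
  by move=> t /f1 H; apply: le_trans H _; rewrite ler_peMr// exprn_ege1.
case: f3 => f' [f3 f4]; exists f'; split => //.
rewrite mulr1 exprS mulrA; apply: IH => //.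
by rewrite mulr_ge0// (le_trans _ r1).
Qed.

(** A smooth step falling from 1 on [x <= 0] to 0 on [1 <= x]. Composing [flat 0] with itself leaves
    only a constant in the denominator, so no quotient has to be differentiated. *)
Definition cutoff x : R := flat 0 (flat 0 1 - flat 0 x) / flat 0 (flat 0 1).

Lemma flat0_homo x y : x <= y -> flat 0 x <= flat 0 y.
Proof.
move=> xy; case: (ltP 0 x) => [x0|/(flat_le0 0) ->]; last exact: flat_ge0.
rewrite /flat x0 (lt_le_trans x0 xy) !expr0 !mul1r ler_expR lerN2.
by rewrite lef_pV2// posrE// (lt_le_trans x0 xy).
Qed.

Lemma cutoff_le0 x : x <= 0 -> cutoff x = 1.
Proof.
move=> x0; rewrite /cutoff [flat 0 x]flat_le0// subr0 divff//.
by rewrite gt_eqF// !flat_gt0.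
Qed.

Lemma cutoff_ge1 x : 1 <= x -> cutoff x = 0.
Proof.
move=> x1; rewrite /cutoff [X in X / _]flat_le0 ?mul0r//.
by rewrite subr_le0 flat0_homo.
Qed.

Lemma cutoff_ge0 x : 0 <= cutoff x.
Proof. by rewrite divr_ge0 ?flat_ge0. Qed.

Lemma cutoff_le1 x : cutoff x <= 1.
Proof.
rewrite ler_pdivrMr ?flat_gt0// mul1r flat0_homo// lerBlDr lerDl; exact: flat_ge0.
Qed.

Lemma Cbound_cutoff k :
  exists2 C : R, 0 <= C & Cbound setT false k 1 C (fun x => (cutoff x)%:C).
Proof.
have [C C0 H] := Cbound_flat k 0.
have H1 : Cbound setT false k 1 (`|flat 0 1| + normc (-1) * C)
    (fun x => (flat 0 1 - flat 0 x)%:C).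
  rewrite -normc_real; under eq_fun do rewrite rmorphB /= -mulN1r.
  by apply: CboundD; [apply: Cbound_cst|apply: CboundZ].
set Cu := `|_| + _ in H1; have Cu0 : 0 <= Cu by rewrite addr_ge0// mulr_ge0// normc_ge0.
have H2 := Cbound_comp ler01 C0 Cu0 H H1.
have B1 : 1 <= 1 * (1 + 2 ^+ k * Cu) by rewrite mul1r lerDl mulr_ge0// exprn_ge0.
have H3 := CboundZ ((flat 0 (flat 0 1))^-1%:C) (Cbound_unscale B1 C0 H2).
eexists; last first.
  by under eq_fun do rewrite /cutoff mulrC rmorphM /=; exact: H3.
by rewrite !mulr_ge0 ?normc_ge0 ?exprn_ge0// (le_trans _ B1).
Qed.

(** As for [flat], the two indices give a family whose span is closed under differentiation;
    [bump 0 0] starts the construction. *)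
Definition bump m m' t : R := flat m (t - 1) * flat m' (2 - t).

Lemma is_derive_bump m m' t : is_derive t 1 (bump m m')
  ((bump m.+2 m' t - m%:R * bump m.+1 m' t) -
   (bump m m'.+2 t - m'%:R * bump m m'.+1 t)).
Proof.
have H1 : is_derive t 1 (fun x : R => x - 1) (1 - 0).
  exact: (is_deriveB (is_derive_id t (1 : R)) (is_derive_cst (1 : R) t (1 : R))).
have H2 : is_derive t 1 (fun x : R => 2 - x) (0 - 1).
  exact: (is_deriveB (is_derive_cst (2 : R) t (1 : R)) (is_derive_id t (1 : R))).
have H3 := @is_derive1_comp _ (flat m) (fun x => x - 1) _ _ _ (is_derive_flat m _) H1.
have H4 := @is_derive1_comp _ (flat m') (fun x => 2 - x) _ _ _ (is_derive_flat m' _) H2.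
have H := is_deriveM H3 H4.
apply: (is_derive_eq H); rewrite /bump /GRing.scale /=; ring.
Qed.

Lemma Cbound_bump k m m' : exists2 C : R, 0 <= C &
  Cbound `[1, 2] true k 1 C (fun x => (bump m m' x)%:C).
Proof.
have H0 j j' t : normc (bump j j' t)%:C <= j`!%:R * j'`!%:R.
  rewrite normc_real normrM; apply: ler_pM => //;
  by rewrite ger0_norm ?flat_ge0 ?flat_bound.
have E j j' : (bump j j' 1)%:C = 0 /\ (bump j j' 2)%:C = 0.
  have f0 i : flat i 0 = 0 by rewrite flat_le0.
  by split; rewrite /bump subrr f0 ?mul0r ?mulr0.
elim: k m m' => [|k IH] m m'.
  exists (m`!%:R * m'`!%:R); first exact: mulr_ge0.
  by split=> // t _; exact: cder_cont (cder_real (is_derive_bump m m' t)).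
have [C1 C10 H1] := IH m.+1 m'; have [C2 C20 H2] := IH m.+2 m'.
have [C3 C30 H3] := IH m m'.+1; have [C4 C40 H4] := IH m m'.+2.
have H := CboundD (CboundD H2 (CboundZ (- m%:R%:C) H1))
  (CboundD (CboundZ (-1) H4) (CboundZ (m'%:R%:C) H3)).
set C := (X in Cbound _ _ _ _ X _) in H.
have C0 : 0 <= C by rewrite !addr_ge0// mulr_ge0// normc_ge0.
exists (m`!%:R * m'`!%:R + C); first by rewrite addr_ge0// mulr_ge0.
split=> //.
  by move=> t _; apply: le_trans (H0 _ _ _) _; rewrite lerDl.
eexists; split; last first.
  apply: Cbound_le H => //.
  by rewrite mulr1 lerDr mulr_ge0.
move=> t _; apply: cder_eq (cder_real (is_derive_bump m m' t)) _.
by apply: complex_ext; rewrite ?ReD ?ImD ?ReM ?ImM /=; ring.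
Qed.

End SmoothCutoffs.

(** * Integration of complex-valued functions over [1, 2] *)

Section ComplexIntegral.
Context {R : realType}.
Implicit Types (f g F : R -> R[i]).

Notation normc := (@Normc.normc R).
Notation Re := (@complex.Re R).
Notation Im := (@complex.Im R).
Notation mu := (@lebesgue_measure R).
Notation I12 := (`[1, 2]%classic : set R).

(** The stages of the construction vanish outside [1, 2], so this is their integral over a whole
    period. The factor 1/(2 pi) of Fourier coefficients is dropped throughout. *)
Definition cint f : R[i] :=
  Complex (\int[mu]_(x in I12) Re (f x)) (\int[mu]_(x in I12) Im (f x)).

Lemma integrable12 (u : R -> R) : (forall t, I12 t -> continuous_at t u) ->
  mu.-integrable I12 (EFin \o u).
Proof.
move=> H; apply: continuous_compact_integrable; first exact: segment_compact.
by apply: continuous_in_subspaceT => t /set_mem; exact: H.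
Qed.

Lemma eq_cint f g : (forall t, I12 t -> f t = g t) -> cint f = cint g.
Proof.
by move=> fg; rewrite /cint; congr Complex; apply: eq_Rintegral => t /set_mem It;
  rewrite fg.
Qed.

Lemma mI12 : measurable I12. Proof. exact: measurable_itv. Qed.

Lemma cintD f g : (forall t, I12 t -> ccont f t) -> (forall t, I12 t -> ccont g t) ->
  cint (fun x => f x + g x) = cint f + cint g.
Proof.
move=> hf hg; apply: complex_ext; rewrite ?ReD ?ImD /=.
  under eq_Rintegral do rewrite ReD.
  by rewrite RintegralD//; apply: integrable12 => t It; [exact: (hf t It).1|exact: (hg t It).1].
under eq_Rintegral do rewrite ImD.
by rewrite RintegralD//; apply: integrable12 => t It; [exact: (hf t It).2|exact: (hg t It).2].
Qed.

Lemma cintZ z f : (forall t, I12 t -> ccont f t) -> cint (fun x => z * f x) = z * cint f.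
Proof.
move=> hf.
have h1 : mu.-integrable I12 (EFin \o (fun x => Re (f x))).
  by apply: integrable12 => t It; exact: (hf t It).1.
have h2 : mu.-integrable I12 (EFin \o (fun x => Im (f x))).
  by apply: integrable12 => t It; exact: (hf t It).2.
have hZ a (u : R -> R) : mu.-integrable I12 (EFin \o u) ->
    mu.-integrable I12 (EFin \o (fun x => a * u x)).
  move=> hu; apply: eq_integrable (integrableZl _ a hu); try exact: mI12.
  by move=> x _ /=; rewrite EFinM.
apply: complex_ext; rewrite ?ReM ?ImM /=.
  under eq_Rintegral do rewrite ReM.
  by rewrite RintegralB ?mI12 ?RintegralZl//; exact: hZ.
under eq_Rintegral do rewrite ImM.
by rewrite RintegralD ?mI12 ?RintegralZl//; exact: hZ.
Qed.

Lemma cint0 : cint (fun=> 0) = 0.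
Proof.
have H : forall t, I12 t -> ccont (fun=> 0 : R[i]) t by move=> t _; exact: ccont_cst.
rewrite -[RHS](mul0r (cint (fun=> 0))) -cintZ//; congr cint.
by apply/funext => x; rewrite mul0r.
Qed.

Lemma cintB f g : (forall t, I12 t -> ccont f t) -> (forall t, I12 t -> ccont g t) ->
  cint (fun x => f x - g x) = cint f - cint g.
Proof.
move=> hf hg; rewrite -[- cint g]mulN1r -cintZ// -cintD//; last first.
  by move=> t It; apply: ccontM; [exact: ccont_cst|exact: hg].
by congr cint; apply/funext => x; rewrite mulN1r.
Qed.

Lemma cint_sum n (F : nat -> R -> R[i]) :
  (forall i t, I12 t -> ccont (F i) t) ->
  cint (fun x => \sum_(0 <= i < n) F i x) = \sum_(0 <= i < n) cint (F i).
Proof.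
move=> hF; elim: n => [|n IH].
  rewrite big_nil -[RHS]cint0; apply: eq_cint => t _.
  by rewrite big_nil.
rewrite big_nat_recr //= -IH -cintD; [|by move=> t It; apply: ccont_sum => i; exact: hF|exact: hF].
by congr cint; apply/funext => x; rewrite big_nat_recr.
Qed.

(** The factor 2 comes from bounding the real and imaginary parts separately. *)
Lemma normc_cint_le f (g : R -> R) : (forall t, I12 t -> ccont f t) ->
  (forall t, I12 t -> continuous_at t g) ->
  (forall t, I12 t -> normc (f t) <= g t) ->
  normc (cint f) <= 2 * \int[mu]_(x in I12) g x.
Proof.
move=> hf hg fg; apply: le_trans (normc_le_ReIm _) _.
have ig := integrable12 hg.
have key (u : R -> R) : (forall t, I12 t -> continuous_at t u) ->
    (forall t, I12 t -> `|u t| <= g t) ->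
    `|\int[mu]_(x in I12) u x| <= \int[mu]_(x in I12) g x.
  move=> hu ug; apply: (@le_trans _ _ (\int[mu]_(x in I12) `|u x|)).
    by apply: le_normr_Rintegral; [exact: mI12|exact: integrable12].
  apply: le_Rintegral => //.
  exact: (integrable_norm (integrable12 hu)).
rewrite mulr_natl mulr2n; apply: lerD; apply: key => t It.
- exact: (hf t It).1.
- exact: le_trans (normr_Re_le _) (fg t It).
- exact: (hf t It).2.
- exact: le_trans (normr_Im_le _) (fg t It).
Qed.

Lemma Rintegral12_cst (c : R) : \int[mu]_(x in I12) c = c.
Proof.
rewrite /Rintegral integral_cst ?mI12//= lebesgue_measure_itv /= lte_fin ltr1n /=.
by ring.
Qed.

Lemma normc_cint_bound f (C : R) : (forall t, I12 t -> ccont f t) ->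
  (forall t, I12 t -> normc (f t) <= C) -> normc (cint f) <= 2 * C.
Proof.
move=> hf hC; rewrite -[in leRHS](Rintegral12_cst C).
by apply: normc_cint_le => // t _; exact: cst_continuous.
Qed.

Lemma Rintegral12_FTC (u U : R -> R) : (forall t, I12 t -> is_derive t 1 U (u t)) ->
  (forall t, I12 t -> continuous_at t u) -> \int[mu]_(x in I12) u x = U 2 - U 1.
Proof.
move=> hU hu; rewrite /Rintegral (@continuous_FTC2 _ u U)//; first by rewrite ltr1n.
- by apply: continuous_in_subspaceT => t /set_mem; exact: hu.
- have cU t : I12 t -> continuous_at t U by move=> It; exact: is_derive_cont (hU t It).
  split.
  + move=> t /subset_itv_oo_cc It; exact: (@ex_derive _ _ _ _ _ _ _ (hU t It)).
  + apply: cvg_at_right_filter; apply: cU.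
    by rewrite /= in_itv /= lexx ler1n.
  + apply: cvg_at_left_filter; apply: cU.
    by rewrite /= in_itv /= lexx ler1n.
- move=> t /subset_itv_oo_cc It; rewrite derive1E.
  exact: (@derive_val _ _ _ _ _ _ _ (hU t It)).
Qed.

Lemma cint_FTC f F : (forall t, I12 t -> cder F t (f t)) ->
  (forall t, I12 t -> ccont f t) -> cint f = F 2 - F 1.
Proof.
move=> hF hf.
have hN z : Re (- z) = - Re z /\ Im (- z) = - Im z by case: z.
apply: complex_ext; rewrite ?ReD ?ImD ?(hN _).1 ?(hN _).2 /=.
  apply: (@Rintegral12_FTC (fun x => Re (f x)) (fun x => Re (F x))) => t It.
    exact: (hF t It).1.
  exact: (hf t It).1.
apply: (@Rintegral12_FTC (fun x => Im (f x)) (fun x => Im (F x))) => t It.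
  exact: (hF t It).2.
exact: (hf t It).2.
Qed.

End ComplexIntegral.

(** * Oscillatory integrals with linear and quadratic phases *)

Section OscillatoryIntegrals.
Context {R : realType}.
Implicit Types (f g A : R -> R[i]) (M nu gam : R).

Notation normc := (@Normc.normc R).
Notation mu := (@lebesgue_measure R).
Notation I12 := (`[1, 2]%classic : set R).

(** One formula for all phases: [osc 0 nu 0] is the exponential of a Fourier coefficient,
    [osc M 0 be] the chirp inside a factor, and their products are again of this form. *)
Definition osc M nu gam (t : R) : R[i] := cis (M * t ^+ 2 + nu * t + gam).

Lemma cder_osc M nu gam t :
  cder (osc M nu gam) t ('i * (2 * M * t + nu)%:C * osc M nu gam t).
Proof.
apply: (@cder_cis _ (fun x => M * x ^+ 2 + nu * x + gam)).
have H1 : is_derive t (1 : R) (fun x : R => x) 1 by exact: is_derive_id.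
have H2 := is_deriveX 2 H1.
have H3 := is_deriveM (is_derive_cst M t (1 : R)) H2.
have H4 := is_deriveM (is_derive_cst nu t (1 : R)) H1.
have H5 := is_deriveD (is_deriveD H3 H4) (is_derive_cst gam t (1 : R)).
apply: (is_derive_eq H5); rewrite /GRing.scale /= ?fctE /=; ring.
Qed.

Lemma normc_osc M nu gam t : normc (osc M nu gam t) = 1.
Proof. exact: normc_cis. Qed.

Lemma ccont_osc M nu gam t : ccont (osc M nu gam) t.
Proof. exact: cder_cont (cder_osc M nu gam t). Qed.

Lemma cint_by_parts f f' g g' :
  (forall t, I12 t -> cder f t (f' t)) -> (forall t, I12 t -> cder g t (g' t)) ->
  (forall t, I12 t -> ccont f' t) -> (forall t, I12 t -> ccont g' t) ->
  f 1 = 0 -> f 2 = 0 ->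
  cint (fun x => f x * g' x) = - cint (fun x => f' x * g x).
Proof.
move=> hf hg cf cg f1 f2; apply/eqP; rewrite -addr_eq0 addrC -cintD.
- rewrite (@cint_FTC _ _ (fun x => f x * g x)); first by rewrite f1 f2 !mul0r subrr.
    by move=> t It; apply: cderM; [exact: hf|exact: hg].
  move=> t It; apply: ccontD; apply: ccontM; [exact: cf|exact: cder_cont (hg t It)|..].
    exact: cder_cont (hf t It).
  exact: cg.
- by move=> t It; apply: ccontM; [exact: cf|exact: cder_cont (hg t It)].
- by move=> t It; apply: ccontM; [exact: cder_cont (hf t It)|exact: cg].
Qed.

(** One integration by parts against [osc 0 nu gam], whose derivative is ['i * nu] times itself; the
    sign of [nu] is free here. *)
Lemma cint_osc_linear A A' (K nu gam : R) :
  (forall t, I12 t -> cder A t (A' t)) -> (forall t, I12 t -> ccont A' t) ->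
  (forall t, I12 t -> normc (A' t) <= K) -> A 1 = 0 -> A 2 = 0 -> nu != 0 ->
  normc (cint (fun t => A t * osc 0 nu gam t)) <= 2 * K / `|nu|.
Proof.
move=> hA cA' bA' A1 A2 nu0.
have cA t : I12 t -> ccont A t by move=> It; exact: cder_cont (hA t It).
have E : 'i * nu%:C * cint (fun t => A t * osc 0 nu gam t) =
    - cint (fun t => A' t * osc 0 nu gam t).
  rewrite -cintZ; last by move=> t It; apply: ccontM; [exact: cA|exact: ccont_osc].
  rewrite -(@cint_by_parts A A' _ (fun t => 'i * nu%:C * osc 0 nu gam t))//.
  - by congr cint; apply/funext => t; ring.
  - move=> t It; apply: cder_eq (cder_osc 0 nu gam t) _.
    by rewrite mulr0 mul0r add0r.
  - by move=> t It; apply: ccontM; [exact: ccont_cst|exact: ccont_osc].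
rewrite ler_pdivlMr ?normr_gt0// mulrC.
rewrite -[X in X * _](_ : normc ('i * nu%:C) = _); last by rewrite Normc.normcM normc_i mul1r normc_real.
rewrite -Normc.normcM E normcN; apply: normc_cint_bound.
  by move=> t It; apply: ccontM; [exact: cA'|exact: ccont_osc].
by move=> t It; rewrite Normc.normcM normc_osc mulr1; exact: bA'.
Qed.

(* The multiplier [b = u / (u ^ 2 + 1 / N ^ 2) / (2 M)], with [u] the distance
   to the stationary point, makes [(b * osc)' = osc] up to terms whose
   integral is [O (1 / N)]. *)
Lemma cint_osc_quadratic A A' (K M N nu gam : R) :
  (forall t, I12 t -> cder A t (A' t)) -> (forall t, I12 t -> ccont A' t) ->
  (forall t, I12 t -> normc (A t) <= K) -> (forall t, I12 t -> normc (A' t) <= K) ->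
  A 1 = 0 -> A 2 = 0 -> 0 < N -> N ^+ 2 <= M ->
  normc (cint (fun t => A t * osc M nu gam t)) <= 13 * K / N.
Proof.
move=> hA cA' bA bA' A1 A2 N0 NM.
have cA t : I12 t -> ccont A t by move=> It; exact: cder_cont (hA t It).
have M0 : 0 < M by apply: lt_le_trans NM; exact: exprn_gt0.
pose u t := t + nu / (2 * M).
(* [W] is concentrated within about [1 / N] of the stationary point [- nu / (2 * M)], and its
   integral is O(1 / N). *)
pose W t := (1 + (N * u t) ^+ 2)^-1.
have den t : 0 < 1 + (N * u t) ^+ 2 by rewrite ltr_pwDl// sqr_ge0.
have W0 t : 0 < W t by rewrite invr_gt0.
have W1 t : W t <= 1 by rewrite invf_le1// lerDl sqr_ge0.
have W2 t : W t * (N * u t) ^+ 2 = 1 - W t.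
  by rewrite /W; field; rewrite gt_eqF.
pose b t := N ^+ 2 / (2 * M) * (u t * W t).
pose b' t := N ^+ 2 / (2 * M) * (W t * (2 * W t - 1)).
have du t : is_derive t (1 : R) u 1.
  have H := is_deriveD (is_derive_id t (1 : R)) (is_derive_cst (nu / (2 * M)) t (1 : R)).
  by apply: (is_derive_eq H); rewrite addr0.
have dNu t : is_derive t (1 : R) (fun x => N * u x) N.
  have H := is_deriveM (is_derive_cst N t (1 : R)) (du t).
  by apply: (is_derive_eq H); rewrite /GRing.scale /=; ring.
have dW t : is_derive t (1 : R) W (- 2 * N * (N * u t) * W t ^+ 2).
  have H := is_deriveD (is_derive_cst (1 : R) t (1 : R)) (is_deriveX 2 (dNu t)).
  have H' : is_derive t (1 : R) W _ :=
    @is_deriveV _ (fun x => 1 + (N * u x) ^+ 2) _ _ _ (lt0r_neq0 (den t)) H.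
  by apply: (is_derive_eq H'); rewrite /W /GRing.scale /= exprVn; ring.
have db t : is_derive t (1 : R) b (b' t).
  have H := is_deriveM (is_derive_cst (N ^+ 2 / (2 * M)) t (1 : R)) (is_deriveM (du t) (dW t)).
  apply: (is_derive_eq H); rewrite /b' /GRing.scale /=.
  transitivity (N ^+ 2 / (2 * M) * (W t - 2 * W t * (W t * (N * u t) ^+ 2))); first by ring.
  by rewrite W2; ring.
have cW t : continuous_at t W by exact: is_derive_cont (dW t).
have cb' t : continuous_at t b'.
  have -> : b' = (fun x => N ^+ 2 / (2 * M) * (W x * (2 * W x - 1))) by [].
  apply: cont_atM; first exact: cont_at_cst.
  apply: cont_atM; first exact: cW.
  apply: cont_atD; last exact: cont_at_cst.
  by apply: cont_atM; [exact: cont_at_cst|exact: cW].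
have NM1 : N ^+ 2 / (2 * M) <= 2^-1.
  by rewrite ler_pdivrMr ?mulr_gt0// mulrA mulVf ?mul1r// pnatr_eq0.
have NM0 : 0 <= N ^+ 2 / (2 * M) by rewrite divr_ge0 ?sqr_ge0// mulr_ge0// ltW.
have bb t : `|b t| <= (4 * N)^-1.
  have H : `|N * u t * W t| <= 2^-1.
    rewrite normrM (ger0_norm (ltW (W0 t))) ler_pdivrMr//.
    have := sqr_ge0 (`|N * u t| - 1); rewrite -(real_normK (num_real (N * u t))).
    by move: `|_| => v; nra.
  have -> : b t = N^-1 * (N ^+ 2 / (2 * M) * (N * u t * W t)).
    by rewrite /b; field; rewrite !gt_eqF.
  rewrite normrM (@ger0_norm _ N^-1) ?invr_ge0 ?(ltW N0)// normrM (ger0_norm NM0).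
  apply: (@le_trans _ _ (N^-1 * (2^-1 * 2^-1))); last first.
    by rewrite le_eqVlt; apply/orP; left; apply/eqP; field; rewrite gt_eqF.
  by rewrite ler_wpM2l ?invr_ge0 ?(ltW N0)// ler_pM.
have bb' t : `|b' t| <= 2^-1 * W t.
  rewrite normrM (ger0_norm NM0) ler_pM// normrM (ger0_norm (ltW (W0 t))).
  rewrite ler_piMr ?(ltW (W0 t))// ler_norml; have := W0 t; have := W1 t; lra.
have K0 : 0 <= K.
  by apply: le_trans (normc_ge0 (A 1)) (bA _ _); rewrite /= in_itv /= lexx ler1n.
(* Since [b t * (2 * M * t + nu) = 1 - W t], the multiplier satisfies
   [B t * e' t = (1 - W t) * e t]. Integrating [A * B * e'] by parts leaves only terms controlled by
   [W] and [b]. *)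
pose B t : R[i] := (- 'i) * (b t)%:C.
pose e := osc M nu gam.
pose e' t := 'i * (2 * M * t + nu)%:C * e t.
have E t : A t * e t = A t * B t * e' t + (W t)%:C * A t * e t.
  have -> : A t * B t * e' t = (- ('i * 'i)) * (b t * (2 * M * t + nu))%:C * (A t * e t).
    by rewrite /B /e' (rmorphM _ (b t)) /=; move: (b t)%:C (_ + nu)%:C => x y; ring.
  have -> : b t * (2 * M * t + nu) = 1 - W t.
    by rewrite -W2 /b /u; field; rewrite gt_eqF.
  have -> : 'i * 'i = -1 :> R[i] by rewrite -expr2 sqr_i.
  by rewrite opprK mul1r rmorphB /= mulrBl mul1r -mulrA subrK.
have cB t : cder B t ((- 'i) * (b' t)%:C).
  apply: cder_eq (cderM (cder_cst (- 'i) t) (cder_real (db t))) _.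
  by rewrite mul0r add0r.
have ccr (v : R -> R) t : continuous_at t v -> ccont (fun x => (v x)%:C) t.
  by move=> cv; split => //=; exact: cont_at_cst.
have cB' t : ccont (fun x => (- 'i) * (b' x)%:C) t.
  by apply: ccontM; [exact: ccont_cst|exact: ccr].
have ce' t : ccont e' t.
  apply: ccontM; last exact: ccont_osc.
  apply: ccontM; first exact: ccont_cst.
  apply: ccr; apply: cont_atD; last exact: cont_at_cst.
  apply: cont_atM; first exact: cont_at_cst.
  exact: cont_at_id.
pose G t := A' t * B t + A t * ((- 'i) * (b' t)%:C).
have cG t : I12 t -> ccont G t.
  move=> It; apply: ccontD; apply: ccontM.
  - exact: cA'.
  - exact: cder_cont (cB t).
  - exact: cA.
  - exact: cB'.
have cWA t : I12 t -> ccont (fun t => (W t)%:C * A t) t.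
  by move=> It; apply: ccontM; [exact: ccr|exact: cA].
have -> : cint (fun t => A t * osc M nu gam t) =
    cint (fun t => ((W t)%:C * A t - G t) * e t).
  transitivity (cint (fun t => A t * B t * e' t) + cint (fun t => (W t)%:C * A t * e t)).
    rewrite -cintD; first by congr cint; apply/funext => t; exact: E.
    - move=> t It; apply: ccontM; last exact: ce'.
      by apply: ccontM; [exact: cA|exact: cder_cont (cB t)].
    - by move=> t It; apply: ccontM; [exact: cWA|exact: ccont_osc].
  rewrite (@cint_by_parts (fun t => A t * B t) G e e')//; first last.
  - by rewrite A2 mul0r.
  - by rewrite A1 mul0r.
  - by move=> t It; exact: cder_osc.
  - by move=> t It; apply: cderM; [exact: hA|exact: cB].
  rewrite addrC -cintB.
  - by congr cint; apply/funext => t; ring.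
  - by move=> t It; apply: ccontM; [exact: cWA|exact: ccont_osc].
  - by move=> t It; apply: ccontM; [exact: cG|exact: ccont_osc].
(* Majorant of the integrand: [W * A] contributes [K * W], [A' * B] contributes [K / (4 * N)], and
   [A] times the derivative of [B] contributes [K * W / 2]. *)
pose g t := K * (4 * N)^-1 + 3 / 2 * K * W t.
have bB t : normc (B t) <= (4 * N)^-1.
  by rewrite Normc.normcM normcN normc_i mul1r normc_real.
apply: (@le_trans _ _ (2 * \int[mu]_(x in I12) g x)).
  apply: normc_cint_le.
  - move=> t It; apply: ccontM; last exact: ccont_osc.
    under [X in ccont X]eq_fun do rewrite -mulN1r.
    apply: ccontD; first exact: cWA.
    by apply: ccontM; [exact: ccont_cst|exact: cG].
  - move=> t It; apply: cont_atD; first exact: cont_at_cst.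
    by apply: cont_atM; [exact: cont_at_cst|exact: cW].
  - move=> t It; rewrite Normc.normcM normc_osc mulr1.
    apply: le_trans (ler_normcB _ _) _.
    have H1 : normc ((W t)%:C * A t) <= W t * K.
      rewrite Normc.normcM normc_real ger0_norm ?(ltW (W0 t))// ler_wpM2l ?(ltW (W0 t))//.
      exact: bA.
    have H2 : normc (A' t * B t) <= K * (4 * N)^-1.
      by rewrite Normc.normcM ler_pM ?normc_ge0//; exact: bA'.
    have H3 : normc (A t * (- 'i * (b' t)%:C)) <= K * (2^-1 * W t).
      rewrite 2!Normc.normcM normcN normc_i mul1r normc_real ler_pM ?normc_ge0//; exact: bA.
    have := ler_normcD (A' t * B t) (A t * (- 'i * (b' t)%:C)).
    rewrite /g -/(G t); lra.
(* The integral of [W] is an increment of [atan] divided by [N], below pi / N < 4 / N. In total 2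
   (1/4 + 6) K / N, which 13 K / N covers. *)
pose U t := K * (4 * N)^-1 * t + 3 / 2 * (K / N) * atan (N * u t).
have -> : \int[mu]_(x in I12) g x = U 2 - U 1.
  apply: (@Rintegral12_FTC _ g U).
    move=> t It.
    have H1 := is_deriveM (is_derive_cst (K * (4 * N)^-1) t (1 : R)) (is_derive_id t (1 : R)).
    have H2 := @is_derive1_comp _ atan (fun x => N * u x) _ _ _ (is_derive1_atan _) (dNu t).
    have H3 := is_deriveM (is_derive_cst (3 / 2 * (K / N)) t (1 : R)) H2.
    apply: (is_derive_eq (is_deriveD H1 H3)).
    rewrite /g /W /GRing.scale /=.
    by field; rewrite !gt_eqF.
  move=> t It; apply: cont_atD; first exact: cont_at_cst.
  by apply: cont_atM; [exact: cont_at_cst|exact: cW].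
have := pihalf_lt2 R; have a1 := atan_ltpi2 (N * u 2); have a2 := atan_gtNpi2 (N * u 1).
move=> p4; rewrite /U.
have KN : 0 <= K / N by rewrite divr_ge0// ltW.
have -> : K * (4 * N)^-1 = K / N / 4 by field; rewrite gt_eqF.
have -> : 13 * K / N = 13 * (K / N) by rewrite mulrA.
have : 3 / 2 * (K / N) * (atan (N * u 2) - atan (N * u 1)) <= 3 / 2 * (K / N) * 4.
  by apply: ler_wpM2l; [exact: mulr_ge0|lra].
lra.
Qed.

(** Differentiation multiplies the inverse by [- 2 * M / (2 * M * t + nu)], which is bounded on
    [1, 2] uniformly in [M] and [nu]: hence a scale [rho] independent of both. *)
Lemma Cbound_inv_affine k : exists2 rho : R, 1 <= rho &
  forall M nu, 0 <= M -> 0 <= nu -> 0 < M + nu ->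
  Cbound I12 false k rho (M + nu)^-1 (fun t => ((2 * M * t + nu)^-1)%:C).
Proof.
have key M nu t : 0 <= M -> 0 <= nu -> 0 < M + nu -> I12 t ->
    0 < 2 * M * t + nu /\ normc ((2 * M * t + nu)^-1)%:C <= (M + nu)^-1.
  move=> M0 nu0 Mnu It.
  have /andP[t1 t2] : 1 <= t <= 2 by move: It; rewrite /= in_itv.
  have H : M + nu <= 2 * M * t + nu by nra.
  have H' : 0 < 2 * M * t + nu by exact: lt_le_trans H.
  by rewrite normc_real ger0_norm ?invr_ge0 ?(ltW H')// lef_pV2.
have dG M nu t : 0 <= M -> 0 <= nu -> 0 < M + nu -> I12 t ->
    is_derive t (1 : R) (fun t => (2 * M * t + nu)^-1)
      (- 2 * M * (2 * M * t + nu)^-1 * (2 * M * t + nu)^-1).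
  move=> M0 nu0 Mnu It; have [p0 _] := key _ _ _ M0 nu0 Mnu It.
  have H1 := is_deriveM (is_derive_cst (2 * M) t (1 : R)) (is_derive_id t (1 : R)).
  have H2 := is_deriveD H1 (is_derive_cst nu t (1 : R)).
  have H3 := @is_deriveV _ (fun x => 2 * M * x + nu) _ _ _ (lt0r_neq0 p0) H2.
  apply: (is_derive_eq H3); rewrite /GRing.scale /=.
  by rewrite -exprVn; ring.
elim: k => [|k [rho rho1 IH]].
  exists 1 => // M nu M0 nu0 Mnu; split => //.
    by move=> t It; have [] := key _ _ _ M0 nu0 Mnu It.
  by move=> t It; apply: cder_cont; exact: cder_real (dG _ _ _ M0 nu0 Mnu It).
have p0 : 0 <= (2 : R) ^+ k.+1 by exact: exprn_ge0.
have rho0 : 0 <= rho by rewrite (le_trans _ rho1).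
exists (rho + 2 ^+ k.+1); first by rewrite (le_trans rho1)// lerDl.
move=> M nu M0 nu0 Mnu; split => //.
  by move=> t It; have [] := key _ _ _ M0 nu0 Mnu It.
have i0 : 0 <= (M + nu)^-1 by rewrite invr_ge0 ltW.
exists (fun t => (- 2 * M)%:C * (((2 * M * t + nu)^-1)%:C * ((2 * M * t + nu)^-1)%:C)); split.
  move=> t It; apply: cder_eq (cder_real (dG _ _ _ M0 nu0 Mnu It)) _.
  by rewrite !rmorphM /=; ring.
have H := IH _ _ M0 nu0 Mnu.
have H2 := CboundZ (- 2 * M)%:C (CboundM rho0 i0 i0 H H).
apply: Cbound_le H2 => //; first by rewrite lerDl.
  by rewrite !mulr_ge0 ?normc_ge0 ?exprn_ge0.
have -> : normc (- 2 * M)%:C = 2 * M.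
  by rewrite normc_real mulNr normrN ger0_norm// mulr_ge0.
have -> : 2 * M * (2 ^+ k * (M + nu)^-1 / (M + nu)) =
    (M + nu)^-1 * (2 ^+ k.+1 * (M / (M + nu))) by rewrite exprS; ring.
apply: ler_wpM2l => //; apply: (@le_trans _ _ (2 ^+ k.+1 * 1)).
  by apply: ler_wpM2l => //; rewrite ler_pdivrMr// mul1r lerDl.
by rewrite mulr1 lerDr.
Qed.

(** Integrate by parts [k] times, each time replacing [f] by the derivative of
    [f / (2 * M * t + nu)]. For nonnegative [M] and [nu] the phase has derivative at least [M + nu]
    on [1, 2], so there is no stationary point and each step gains [r / (M + nu)] up to a
    constant. *)
Lemma cint_osc_nonstationary k : exists2 H : R, 0 <= H &
  forall f r C M nu gam, 1 <= r -> 0 <= C -> 0 <= M -> 0 <= nu -> 0 < M + nu ->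
  Cbound I12 true k r C f ->
  normc (cint (fun t => f t * osc M nu gam t)) <= H * C * (r / (M + nu)) ^+ k.
Proof.
elim: k => [|k [H H0 IH]].
  exists 2 => // f r C M nu gam r1 C0 M0 nu0 Mnu Hf; rewrite expr0 mulr1.
  apply: normc_cint_bound => t It.
    by apply: ccontM; [exact: Cbound_cont Hf It|exact: ccont_osc].
  by rewrite Normc.normcM normc_osc mulr1; exact: Cbound_le_norm Hf It.
have [rho rho1 HG] := Cbound_inv_affine k.+1.
have rho0 : 0 <= rho by rewrite (le_trans _ rho1).
exists (H * 2 ^+ k.+1 * (1 + rho) ^+ k.+1).
  by rewrite !mulr_ge0// exprn_ge0// addr_ge0.
move=> f r C M nu gam r1 C0 M0 nu0 Mnu Hf.
have r0 : 0 <= r by rewrite (le_trans _ r1).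
have i0 : 0 <= (M + nu)^-1 by rewrite invr_ge0 ltW.
pose G t : R[i] := ((2 * M * t + nu)^-1)%:C.
have rr : 1 <= r + rho by rewrite (le_trans r1)// lerDl.
have rr0 : 0 <= r + rho by rewrite (le_trans _ rr).
have HfG : Cbound I12 true k.+1 (r + rho) (2 ^+ k.+1 * C * (M + nu)^-1) (fun t => f t * G t).
  apply: CboundM => //.
    by apply: Cbound_le Hf => //; rewrite lerDl.
  by apply: Cbound_le (HG _ _ M0 nu0 Mnu) => //; rewrite lerDr.
(* [h'], the derivative of [f * G], takes the place of [f] in the induction hypothesis, at scale
   [r + rho <= (1 + rho) * r]. *)
case: HfG => [_ /(_ isT) [e1 e2] [h' [dh Hh]]].
have E : 'i * cint (fun t => f t * osc M nu gam t) = - cint (fun t => h' t * osc M nu gam t).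
  rewrite -cintZ; last first.
    by move=> t It; apply: ccontM; [exact: Cbound_cont Hf It|exact: ccont_osc].
  rewrite -(@cint_by_parts (fun t => f t * G t) h' _
    (fun t => 'i * (2 * M * t + nu)%:C * osc M nu gam t))//.
  - apply: eq_cint => t It; have /andP[t1 t2] : 1 <= t <= 2 by move: It; rewrite /= in_itv.
    have GE : G t * (2 * M * t + nu)%:C = 1.
      by rewrite -rmorphM /= mulVf// gt_eqF//; nra.
    by rewrite -[LHS]mul1r -GE; ring.
  - by move=> t It; exact: cder_osc.
  - by move=> t It; exact: Cbound_cont Hh It.
  - move=> t It; apply: ccontM; last exact: ccont_osc.
    apply: ccontM; first exact: ccont_cst.
    split => /=; last exact: cont_at_cst.
    apply: cont_atD; last exact: cont_at_cst.
    by apply: cont_atM; [exact: cont_at_cst|exact: cont_at_id].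
have -> : normc (cint (fun t => f t * osc M nu gam t)) =
    normc (cint (fun t => h' t * osc M nu gam t)).
  by rewrite -[LHS]mul1r -normc_i -Normc.normcM E normcN.
have C'0 : 0 <= 2 ^+ k.+1 * C / (M + nu) * (r + rho).
  by rewrite !mulr_ge0// exprn_ge0.
apply: le_trans (IH _ _ _ _ _ gam rr C'0 M0 nu0 Mnu Hh) _.
have -> : H * (2 ^+ k.+1 * C / (M + nu) * (r + rho)) * ((r + rho) / (M + nu)) ^+ k =
    H * 2 ^+ k.+1 * C * ((r + rho) / (M + nu)) ^+ k.+1 by rewrite (exprS ((r + rho) / (M + nu))); ring.
have -> : H * 2 ^+ k.+1 * (1 + rho) ^+ k.+1 * C * (r / (M + nu)) ^+ k.+1 =
    H * 2 ^+ k.+1 * C * ((1 + rho) * (r / (M + nu))) ^+ k.+1 by rewrite [in RHS]exprMn; ring.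
apply: ler_wpM2l; first by rewrite !mulr_ge0// exprn_ge0.
apply: lerXn2r; rewrite ?nnegrE ?mulr_ge0 ?addr_ge0//.
rewrite mulrA ler_wpM2r//; nra.
Qed.

End OscillatoryIntegrals.

(** * The factor (1 - e^(is))^l X(s) and its truncation error *)

Section Factor.
Context {R : realType}.
Implicit Types (f g A : R -> R[i]) (M nu be x : R) (k l : nat).

Notation normc := (@Normc.normc R).
Notation Re := (@complex.Re R).
Notation I12 := (`[1, 2]%classic : set R).

Definition oneBosc M be t : R[i] := 1 - osc M 0 be t.

(** This is 1 - cos s, half of |1 - e^(is)|^2: a smooth substitute for the distance from s to 2 pi
    Z. *)
Definition vercos M be t : R := Re (oneBosc M be t).

(** The complement 1 - X of the cutoff X of the opening comment: it is 1 where [vercos] is at most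
    [x], and 0 where [vercos] is at least [2 * x]. *)
Definition window x M be t : R := cutoff (vercos M be t / x - 1).

Lemma window1 x M be t : 0 < x -> vercos M be t <= x -> window x M be t = 1.
Proof. by move=> x0 H; rewrite /window cutoff_le0// subr_le0 ler_pdivrMr// mul1r. Qed.

Lemma window0 x M be t : 0 < x -> 2 * x <= vercos M be t -> window x M be t = 0.
Proof.
by move=> x0 H; rewrite /window cutoff_ge1// lerBrDr ler_pdivlMr// -mulr2n mulr_natl -mulr_natl.
Qed.

Lemma vercosE M be t : vercos M be t = 1 - cos (M * t ^+ 2 + be).
Proof. by rewrite /vercos /oneBosc /= mul0r addr0. Qed.

Lemma normc_oneBosc M be t : normc (oneBosc M be t) ^+ 2 = 2 * vercos M be t.
Proof.
rewrite vercosE /oneBosc /osc mul0r addr0.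
rewrite /= add0r sqrrN sqr_sqrtr ?addr_ge0 ?sqr_ge0//.
by have := cos2Dsin2 (M * t ^+ 2 + be); nra.
Qed.

(** On [1, 2] the phase has derivative at most [4 * M], so the scale is proportional to [M], with a
    ratio that depends on [k] only. *)
Lemma Cbound_osc k : exists2 E : R, 1 <= E & forall M be, 1 <= M ->
  Cbound I12 false k (M * E) 1 (osc M 0 be).
Proof.
elim: k => [|k [E E1 IH]].
  exists 1 => // M be M1; split => //.
    by move=> t _; rewrite normc_osc.
  by move=> t _; exact: ccont_osc.
have E0 : 0 <= E by rewrite (le_trans _ E1).
have p0 : 0 <= (2 : R) ^+ k * 4 by rewrite mulr_ge0 ?exprn_ge0.
exists (E + 2 ^+ k * 4); first by rewrite (le_trans E1)// lerDl.
move=> M be M1; split => //; first by move=> t _; rewrite normc_osc.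
exists (fun t => 'i * (2 * M * t + 0)%:C * osc M 0 be t); split.
  by move=> t _; exact: cder_osc.
have M0 : 0 <= M by rewrite (le_trans _ M1).
have ME0 : 0 <= M * E by exact: mulr_ge0.
have Hlin : Cbound I12 false k (M * E) (4 * M) (fun t => 'i * (2 * M * t + 0)%:C).
  have dl (t : R) : cder (fun t => 'i * (2 * M * t + 0)%:C) t ('i * (2 * M)%:C).
    have H1 := is_deriveM (is_derive_cst (2 * M) t (1 : R)) (is_derive_id t (1 : R)).
    have H2 := is_deriveD H1 (is_derive_cst 0 t (1 : R)).
    apply: cder_eq (cderM (cder_cst 'i t) (cder_real H2)) _.
    rewrite mul0r add0r; congr (_ * _); congr (_%:C).
    by rewrite /GRing.scale /=; ring.
  have b0 t : I12 t -> normc ('i * (2 * M * t + 0)%:C) <= 4 * M.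
    move=> It; have /andP[t1 t2] : 1 <= t <= 2 by move: It; rewrite /= in_itv.
    by rewrite Normc.normcM normc_i mul1r normc_real addr0 ger0_norm; nra.
  case: k {IH} p0 => [|k] p0; split => //.
    by move=> t _; exact: cder_cont (dl t).
  exists (fun=> 'i * (2 * M)%:C); split => //.
  apply: Cbound_cst => //; rewrite Normc.normcM normc_i mul1r normc_real ger0_norm ?mulr_ge0//.
  have : 1 <= M * E by rewrite mulr_ege1.
  nra.
have H := CboundM ME0 (mulr_ge0 (ler0n _ 4) M0) ler01 Hlin (IH M be M1).
apply: Cbound_le H => //.
- by rewrite ler_wpM2l// lerDl.
- by rewrite !mulr_ge0// exprn_ge0.
- rewrite mulr1 mul1r mulrDr mulrA [M * _]mulrC -[leLHS]addr0 addrC.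
  by rewrite [4 * M]mulrC !mulrA [2 ^+ k * M]mulrC lerD2r; nra.
Qed.

Lemma Cbound_oneBosc k : exists2 E : R, 1 <= E & forall M be, 1 <= M ->
  Cbound I12 false k (M * E) 2 (oneBosc M be).
Proof.
have [E E1 H] := Cbound_osc k; exists E => // M be M1.
have E0 : 0 <= E by rewrite (le_trans _ E1).
have M0 : 0 <= M by rewrite (le_trans _ M1).
have ME0 : 0 <= M * E by exact: mulr_ge0.
have -> : oneBosc M be = (fun t => 1 + (-1) * osc M 0 be t).
  by apply/funext => t; rewrite mulN1r.
have H1 : Cbound I12 false k (M * E) 1 (fun=> 1 : R[i]).
  by apply: Cbound_cst; rewrite ?Normc.normc1.
have := CboundD H1 (CboundZ (-1) (H M be M1)).
by rewrite normcN Normc.normc1 mulr1.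
Qed.

Lemma Cbound_window k x : 0 < x -> exists E C : R, [/\ 1 <= E, 0 <= C &
  forall M be, 1 <= M -> Cbound I12 false k (M * E) C (fun t => (window x M be t)%:C)].
Proof.
move=> x0; have [E E1 H] := Cbound_oneBosc k.
have [C C0 HC] := @Cbound_cutoff R k.
have E0 : 0 <= E by rewrite (le_trans _ E1).
pose Cu : R := x^-1 * 2 + 1.
have Cu0 : 0 <= Cu by rewrite addr_ge0// mulr_ge0// invr_ge0 ltW.
have p0 : 0 <= 2 ^+ k * Cu by rewrite mulr_ge0// exprn_ge0.
exists (E * (1 + 2 ^+ k * Cu)), C; split => //.
  by rewrite mulr_ege1// lerDl.
move=> M be M1; have M0 : 0 <= M by rewrite (le_trans _ M1).
have ME0 : 0 <= M * E by exact: mulr_ge0.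
rewrite mulrA.
apply: (@Cbound_comp _ _ k (M * E) C Cu (fun x => (cutoff x)%:C)
  (fun t => vercos M be t / x - 1)) => //.
have -> : Cu = normc x^-1%:C * 2 + 1 by rewrite normc_real ger0_norm// invr_ge0 ltW.
have -> : (fun t => (vercos M be t / x - 1)%:C) =
    (fun t => x^-1%:C * (vercos M be t)%:C + (-1)).
  by apply/funext => t; rewrite rmorphB /= rmorphM /= mulrC.
apply: CboundD; last by apply: Cbound_cst; rewrite ?normcN ?Normc.normc1.
by apply: CboundZ; apply: Cbound_Re; exact: H.
Qed.

(* The width of the dead zone: [16 ^ (l k) * (2 ^ k * width k) ^ l = 4 ^- l]
   is what remains of the remainder after [k] derivatives. *)
Definition width k : R := 2^-1 ^+ (5 * k + 2).
Definition dead k : R := 2^-1 ^+ (10 * k + 7).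

Lemma width_gt0 k : 0 < width k. Proof. by rewrite exprn_gt0 ?invr_gt0. Qed.
Lemma dead_gt0 k : 0 < dead k. Proof. by rewrite exprn_gt0 ?invr_gt0. Qed.
(** As |1 - e^(is)|^2 is twice [vercos], this gives |1 - e^(is)| <= [width k] as soon as [vercos] is
    at most [4 * dead k], hence wherever the window of parameter [2 * dead k] is nonzero. *)
Lemma width_dead k : width k ^+ 2 = 8 * dead k.
Proof.
rewrite /width /dead -exprM.
have -> : (10 * k + 7 = 3 + (5 * k + 2) * 2)%N by lia.
by rewrite [in RHS]exprD mulrA !exprS expr0; field.
Qed.

Definition remainder k l be t : R[i] :=
  oneBosc (16 ^+ l) be t ^+ l * (window (dead k) (16 ^+ l) be t)%:C.

Definition factor k l be t : R[i] :=
  oneBosc (16 ^+ l) be t ^+ l * (1 - (window (dead k) (16 ^+ l) be t)%:C).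

Lemma exp16_ge1 l : 1 <= (16 : R) ^+ l.
Proof. by rewrite exprn_ege1// ler1n. Qed.

(** The remainder is [h ^+ l] times a window, for a base [h] of modulus at most [width k] everywhere
    on [1, 2]. At a scale enlarged by a fixed factor the derivatives of [h] obey the same small
    constant, so the power decays geometrically in [l]. *)
Lemma Cbound_remainder k : exists B K : R, [/\ 1 <= B, 0 <= K &
  forall l be, Cbound I12 false k (16 ^+ l * B) (K * (2 ^+ k * width k) ^+ l)
    (remainder k l be)].
Proof.
have d0 := dead_gt0 k; have w0 := width_gt0 k.
have dd0 : 0 < 2 * dead k by rewrite mulr_gt0.
have [E1 E11 H1] := Cbound_oneBosc k.
have [E2 [C2 [E21 C20 H2]]] := Cbound_window k d0.
have [E3 [C3 [E31 C30 H3]]] := Cbound_window k dd0.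
have E10 : 0 <= E1 by rewrite (le_trans _ E11).
have E20 : 0 <= E2 by rewrite (le_trans _ E21).
have E30 : 0 <= E3 by rewrite (le_trans _ E31).
pose E := E1 + E2 + E3; have E0 : 0 <= E by rewrite !addr_ge0.
have EE1 : 1 <= E by rewrite (le_trans E11)// /E -addrA lerDl addr_ge0.
pose C := 2 ^+ k * 2 * C3; have C0 : 0 <= C by rewrite !mulr_ge0// exprn_ge0.
(* Chosen so that [C <= width k * B], as [Cbound_small] requires. *)
pose B := 1 + C / width k; have B1 : 1 <= B by rewrite lerDl divr_ge0// ltW.
have p0 : 0 <= 2 ^+ k * width k by rewrite mulr_ge0 ?exprn_ge0// ltW.
exists (E * B), (2 ^+ k * C2); split; [exact: mulr_ege1|by rewrite mulr_ge0 ?exprn_ge0|].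
move=> l be; set M := 16 ^+ l.
have M1 : 1 <= M by exact: exp16_ge1.
have M0 : 0 <= M by rewrite (le_trans _ M1).
have ME0 : 0 <= M * E by exact: mulr_ge0.
have MEB0 : 0 <= M * E * B by rewrite mulr_ge0// (le_trans _ B1).
(* The wider window equals 1 wherever the narrower one is nonzero: inserting it leaves the product
   unchanged and makes the base of the power small on all of [1, 2]. *)
pose h t := oneBosc M be t * (window (2 * dead k) M be t)%:C.
have Hh : Cbound I12 false k (M * E) C h.
  apply: CboundM => //.
    apply: Cbound_le (H1 M be M1); rewrite ?mulr_ge0//.
    by rewrite ler_wpM2l// /E -addrA lerDl addr_ge0.
  apply: Cbound_le (H3 M be M1); rewrite ?mulr_ge0//.
  by rewrite ler_wpM2l// /E lerDr addr_ge0.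
have hw t : I12 t -> normc (h t) <= width k.
  move=> _; rewrite Normc.normcM normc_real ger0_norm ?cutoff_ge0//.
  have [v|v] := leP (2 * (2 * dead k)) (vercos M be t).
    by rewrite window0// mulr0 ltW.
  apply: (@le_trans _ _ (normc (oneBosc M be t) * 1)).
    by rewrite ler_wpM2l ?normc_ge0// cutoff_le1.
  rewrite mulr1 -(@ler_pXn2r _ 2) ?nnegrE ?normc_ge0 ?(ltW w0)//.
  by rewrite normc_oneBosc width_dead; lra.
have Hs : Cbound I12 false k (M * E * B) (width k) h.
  apply: Cbound_small Hh => //; first exact: ltW.
  by rewrite /B mulrDr mulr1 [_ * (_ / _)]mulrC divfK ?gt_eqF// lerDr ltW.
have HX := CboundX l MEB0 (ltW w0) Hs.
have HW : Cbound I12 false k (M * E * B) C2 (fun t => (window (dead k) M be t)%:C).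
  apply: Cbound_le (H2 M be M1); rewrite ?mulr_ge0//.
  rewrite -mulrA ler_wpM2l// (@le_trans _ _ E)//; last by rewrite ler_peMr.
  by rewrite /E addrAC lerDr addr_ge0.
have := CboundM MEB0 (exprn_ge0 l p0) C20 HX HW.
have -> : 2 ^+ k * (2 ^+ k * width k) ^+ l * C2 = 2 ^+ k * C2 * (2 ^+ k * width k) ^+ l by ring.
rewrite mulrA; congr Cbound; apply/funext => t; rewrite /remainder -/M.
have [v|v] := leP (2 * dead k) (vercos M be t).
  by rewrite (@window0 (dead k))// !mulr0.
by rewrite /h (@window1 (2 * dead k)) ?(ltW v)// mulr1.
Qed.

Lemma factor_dead k l be t : vercos (16 ^+ l) be t <= dead k -> factor k l be t = 0.
Proof. by move=> H; rewrite /factor window1 ?dead_gt0// subrr mulr0. Qed.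

Lemma factorE k l be t :
  factor k l be t = oneBosc (16 ^+ l) be t ^+ l - remainder k l be t.
Proof. by rewrite /factor mulrBr mulr1. Qed.

Definition flat12 f := forall k, exists2 C : R, 0 <= C & Cbound I12 true k 1 C f.

Lemma flat12_factor f k l be : flat12 f -> flat12 (fun t => f t * factor k l be t).
Proof.
move=> Hf j; have [C C0 HC] := Hf j.
have M1 := exp16_ge1 l; set M := 16 ^+ l in M1.
have M0 : 0 <= M by rewrite (le_trans _ M1).
have [E1 E11 H1] := Cbound_oneBosc j.
have [E2 [C2 [E21 C20 H2]]] := Cbound_window j (dead_gt0 k).
have E10 : 0 <= E1 by rewrite (le_trans _ E11).
have E20 : 0 <= E2 by rewrite (le_trans _ E21).
pose E := M * (E1 + E2); have EE1 : 1 <= E.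
  by rewrite mulr_ege1// (le_trans E11)// lerDl.
have E0 : 0 <= E by rewrite (le_trans _ EE1).
have HX : Cbound I12 false j E ((2 ^+ j * 2) ^+ l) (fun t => oneBosc M be t ^+ l).
  apply: CboundX => //; apply: Cbound_le (H1 M be M1); rewrite ?mulr_ge0//.
  by rewrite ler_wpM2l// lerDl.
have HW : Cbound I12 false j E (1 + normc (-1) * C2)
    (fun t => 1 - (window (dead k) M be t)%:C).
  have -> : (fun t => 1 - (window (dead k) M be t)%:C) =
      (fun t => 1 + (-1) * (window (dead k) M be t)%:C).
    by apply/funext => t; rewrite mulN1r.
  apply: CboundD; first by apply: Cbound_cst; rewrite ?Normc.normc1.
  apply: CboundZ; apply: Cbound_le (H2 M be M1); rewrite ?mulr_ge0//.
  by rewrite ler_wpM2l// lerDr.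
have c1 : 0 <= (2 ^+ j * 2 : R) ^+ l by rewrite exprn_ge0// mulr_ge0// exprn_ge0.
have c2 : 0 <= 1 + normc (-1) * C2 by rewrite addr_ge0// mulr_ge0// normc_ge0.
have HF := CboundM E0 c1 c2 HX HW.
have HC' : Cbound I12 true j E C f by apply: Cbound_le HC.
have c3 : 0 <= 2 ^+ j * (2 ^+ j * 2) ^+ l * (1 + normc (-1) * C2).
  by rewrite !mulr_ge0// exprn_ge0.
have H := Cbound_unscale EE1 _ (CboundM E0 C0 c3 HC' HF).
eexists; last by apply: H; rewrite mulr_ge0// mulr_ge0// exprn_ge0.
by rewrite !mulr_ge0// exprn_ge0.
Qed.

Lemma oscM M1 M2 nu1 nu2 b1 b2 t :
  osc M1 nu1 b1 t * osc M2 nu2 b2 t = osc (M1 + M2) (nu1 + nu2) (b1 + b2) t.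
Proof. by rewrite /osc -cisD; congr cis; ring. Qed.

Lemma oneBoscX M be l t : oneBosc M be t ^+ l =
  \sum_(0 <= m < l.+1) ((-1) ^+ m *+ 'C(l, m)) * osc (m%:R * M) 0 (m%:R * be) t.
Proof.
rewrite /oneBosc exprBn big_mkord; apply: eq_bigr => m _.
rewrite expr1n mulr1 -mulrnAl; congr (_ * _).
by rewrite /osc cisX; congr cis; ring.
Qed.

(** In the binomial expansion of (1 - e^(is))^l the constant term cancels the subtracted 1. What is
    left has chirp rates [m.+1 * 16 ^+ l] and binomial coefficients of sum below [2 ^+ l]. *)
Lemma cint_factor_bound A k l be nu S T : (forall t, I12 t -> ccont A t) -> 0 <= S ->
  (forall m, normc (cint (fun t => A t * osc (m.+1%:R * 16 ^+ l) nu (m.+1%:R * be) t)) <= S) ->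
  normc (cint (fun t => A t * remainder k l be t * osc 0 nu 0 t)) <= T ->
  normc (cint (fun t => A t * (factor k l be t - 1) * osc 0 nu 0 t)) <= 2 ^+ l * S + T.
Proof.
move=> cA S0 HS HT; pose M : R := 16 ^+ l.
pose c m : R[i] := (-1) ^+ m.+1 *+ 'C(l, m.+1).
have cr t : I12 t -> ccont (remainder k l be) t.
  by have [B [K [_ _ H]]] := Cbound_remainder k => It; exact: Cbound_cont (H l be) It.
have cF m t : I12 t -> ccont (fun t => c m * (A t * osc (m.+1%:R * M) nu (m.+1%:R * be) t)) t.
  move=> It; apply: ccontM; first exact: ccont_cst.
  by apply: ccontM; [exact: cA|exact: ccont_osc].
have cR t : I12 t -> ccont (fun t => A t * remainder k l be t * osc 0 nu 0 t) t.
  move=> It; apply: ccontM; last exact: ccont_osc.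
  by apply: ccontM; [exact: cA|exact: cr].
have -> : cint (fun t => A t * (factor k l be t - 1) * osc 0 nu 0 t) =
  \sum_(0 <= m < l) cint (fun t => c m * (A t * osc (m.+1%:R * M) nu (m.+1%:R * be) t)) -
  cint (fun t => A t * remainder k l be t * osc 0 nu 0 t).
  rewrite -cint_sum// -cintB//; last first.
    by move=> t It; apply: ccont_sum => m; exact: cF.
  congr cint; apply/funext => t; rewrite factorE oneBoscX big_nat_recl//= -/M.
  rewrite bin0 expr0 mulr1n mul1r mul0r.
  have -> : osc 0 0 (0 * be) t = 1 by rewrite /osc !mul0r !addr0 cis0.
  rewrite addrAC [1 + _]addrC addrK mulrBr mulrBl; congr (_ - _).
  rewrite mulr_sumr mulr_suml; apply: eq_bigr => m _; rewrite /c.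
  rewrite mulrCA -!mulrA; congr (_ * (_ * _)).
  by rewrite oscM addr0 add0r addr0.
apply: le_trans (ler_normcB _ _) _; apply: lerD => //.
apply: le_trans (ler_normc_sum _ _ _) _.
apply: (@le_trans _ _ (\sum_(0 <= m < l) 'C(l, m.+1)%:R * S)).
  apply: ler_sum => m _; rewrite cintZ; last first.
    by move=> t It; apply: ccontM; [exact: cA|exact: ccont_osc].
  rewrite Normc.normcM; apply: ler_pM; rewrite ?normc_ge0//.
  rewrite /c -mulr_natr Normc.normcM normcX normcN Normc.normc1 expr1n mul1r.
  by rewrite -(rmorph_nat (real_complex R)) normc_real ger0_norm.
rewrite -mulr_suml ler_wpM2r// -natr_sum -natrX ler_nat.
have -> : (2 ^ l = \sum_(0 <= m < l.+1) 'C(l, m))%N.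
  rewrite big_mkord -[2%N]/(1 + 1)%N expnDn; apply: eq_bigr => i _.
  by rewrite !exp1n !muln1.
by rewrite big_nat_recl// leq_addl.
Qed.

End Factor.

(** * Effect of one factor on the Fourier coefficients *)

Section FactorEstimates.
Context {R : realType}.
Implicit Types (f g A : R -> R[i]) (M nu be x : R) (k l : nat).

Notation normc := (@Normc.normc R).
Notation I12 := (`[1, 2]%classic : set R).

(** Exponent count: [k - (5 * k + 2) + 4 * k = - 2], so the left side is in fact 4^(-l). *)
Lemma width_scale k l : (2 ^+ k * width k) ^+ l * (16 ^+ l) ^+ k <= 2^-1 ^+ l :> R.
Proof.
rewrite -exprM mulnC exprM -exprMn lerXn2r ?nnegrE ?invr_ge0//.
  by rewrite !mulr_ge0 ?exprn_ge0// ltW// width_gt0.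
have -> : (16 : R) ^+ k = 2 ^+ (4 * k) by rewrite exprM; congr (_ ^+ _); rewrite !exprS expr0; ring.
have -> : 2 ^+ k * width k * 2 ^+ (4 * k) = 2^-1 ^+ 2 :> R.
  have e1 : 2 ^+ k * 2 ^+ (4 * k) * 2^-1 ^+ (5 * k) = 1 :> R.
    rewrite -exprD (_ : k + 4 * k = 5 * k)%N; last by lia.
    by rewrite -exprMn divff ?pnatr_eq0// expr1n.
  rewrite /width exprD; move: e1.
  move: (2 ^+ k) (2 ^+ (4 * k)) (2^-1 ^+ (5 * k)) (2^-1 ^+ 2) => a b c d e1.
  by rewrite -[RHS]mul1r -e1; ring.
by rewrite expr2 ler_piMr ?invr_ge0// invf_le1// ler1n.
Qed.

Lemma width_le k l : (2 ^+ k * width k) ^+ l <= 2^-1 ^+ l :> R.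
Proof.
apply: le_trans (width_scale k l); apply: ler_peMr.
  by rewrite exprn_ge0// mulr_ge0 ?exprn_ge0// ltW// width_gt0.
by apply: exprn_ege1; exact: exp16_ge1.
Qed.

Lemma half_pow_small (K e : R) : 0 <= K -> 0 < e -> exists l, K * 2^-1 ^+ l <= e.
Proof.
move=> K0 e0; exists (Num.bound (K / e)).
have /ltW := upper_nthrootP (leqnn (Num.bound (K / e))).
by rewrite exprVn ler_pdivrMr// ler_pdivrMr ?exprn_gt0// mulrC.
Qed.

(** For [nu >= 0] the chirped terms are nonstationary. Of the [k.+1] powers of [(16 ^+ l + nu)^-1]
    gained by parts, [k] give the decay in [nu] and one beats the total coefficient [2 ^+ l]. The
    remainder loses [(16 ^+ l) ^+ k] through its [k] derivatives, which [width_scale] pays for. *)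
Lemma factor_negative_bound f k : flat12 f -> exists2 K : R, 0 <= K &
  forall l be nu, 0 <= nu ->
  normc (cint (fun t => f t * (factor k l be t - 1) * osc 0 nu 0 t)) <=
    K * 2^-1 ^+ l / (1 + nu) ^+ k.
Proof.
move=> Hf; have [C1 C10 H1] := Hf k.+1; have [C2 C20 H2] := Hf k.
have [h1 h10 N1] := @cint_osc_nonstationary R k.+1.
have [h2 h20 N2] := @cint_osc_nonstationary R k.
have [B [K [B1 K0 HR]]] := @Cbound_remainder R k.
have B0 : 0 <= B by rewrite (le_trans _ B1).
pose K2 := (h2 + 2) * (2 ^+ k * C2 * K) * (2 * B) ^+ k.
have K20 : 0 <= K2 by rewrite !mulr_ge0 ?addr_ge0 ?exprn_ge0 ?mulr_ge0.
exists (h1 * C1 + K2); first by rewrite addr_ge0// mulr_ge0.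
move=> l be nu nu0; set M : R := 16 ^+ l.
have M1 : 1 <= M by exact: exp16_ge1.
have M0 : 0 < M by exact: lt_le_trans M1.
have q0 : 0 < (1 + nu) ^+ k by rewrite exprn_gt0// ltr_wpDr.
have cf t : I12 t -> ccont f t by move=> It; exact: Cbound_cont H1 It.
rewrite mulrDl mulrDl.
have -> : h1 * C1 * 2^-1 ^+ l / (1 + nu) ^+ k =
    2 ^+ l * (h1 * C1 * 4^-1 ^+ l / (1 + nu) ^+ k).
  have -> : (4^-1 : R) = 2^-1 * 2^-1 by field.
  have e2 : 2 ^+ l * 2^-1 ^+ l = 1 :> R by rewrite -exprMn divff ?expr1n// pnatr_eq0.
  rewrite exprMn; move: e2; move: (2 ^+ l) (2^-1 ^+ l) => a b e2.
  by rewrite -[LHS]mul1r -[X in X * _ = _]e2; ring.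
apply: cint_factor_bound => //.
- by rewrite !mulr_ge0 ?exprn_ge0 ?invr_ge0// ltW.
- move=> m; have Mm : 0 < m.+1%:R * M + nu by rewrite ltr_pwDl// mulr_gt0.
  have Mm0 : 0 <= m.+1%:R * M by rewrite mulr_ge0// ltW.
  apply: le_trans (N1 f 1 C1 _ nu _ (lexx 1) C10 Mm0 nu0 Mm H1) _.
  rewrite -[leRHS]mulrA; apply: ler_wpM2l; first exact: mulr_ge0.
  have mM : M <= m.+1%:R * M by rewrite ler_peMl ?(ltW M0)// ler1n.
  rewrite mul1r exprVn exprVn -invfM lef_pV2 ?posrE ?exprn_gt0 ?mulr_gt0 ?exprn_gt0//.
  rewrite exprS ler_pM ?exprn_ge0 ?addr_ge0//.
    apply: (@le_trans _ _ M); last by rewrite (le_trans mM)// lerDl.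
    by rewrite lerXn2r ?nnegrE// ler_nat.
  rewrite lerXn2r ?nnegrE ?addr_ge0 ?(ltW Mm)// lerD2r (le_trans M1)//.
  by rewrite ltr_wpDr.
- pose C' := 2 ^+ k * C2 * (K * (2 ^+ k * width k) ^+ l).
  have w0 : 0 <= (2 ^+ k * width k) ^+ l :> R.
    by rewrite exprn_ge0// mulr_ge0 ?exprn_ge0// ltW// width_gt0.
  have C'0 : 0 <= C' by apply: mulr_ge0; apply: mulr_ge0 => //; exact: exprn_ge0.
  have MB1 : 1 <= M * B by exact: mulr_ege1.
  have MB0 : 0 <= M * B by rewrite (le_trans _ MB1).
  have H2' : Cbound I12 true k (M * B) C2 f by apply: Cbound_le H2.
  have Hp : Cbound I12 true k (M * B) C' (fun t => f t * remainder k l be t).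
    by apply: CboundM => //; [exact: mulr_ge0|exact: HR].
  (* Two regimes, served by [h2] and 2 respectively: for [nu >= 1], [k] integrations by parts
     against the linear phase; for [nu < 1], the trivial bound, since [1 + nu] is below
     [2 * (M * B)]. *)
  apply: (@le_trans _ _ ((h2 + 2) * C' * (2 * (M * B)) ^+ k / (1 + nu) ^+ k)).
    have [nu1|nu1] := leP 1 nu.
      have nup : 0 < 0 + nu by rewrite add0r (lt_le_trans _ nu1).
      apply: le_trans (N2 _ _ _ _ _ 0 MB1 C'0 (lexx 0) nu0 nup Hp) _.
      rewrite -[leRHS]mulrA; apply: ler_pM.
      - exact: mulr_ge0.
      - by rewrite exprn_ge0// divr_ge0// ltW.
      - by rewrite ler_wpM2r// lerDl.
      - rewrite -expr_div_n; apply: lerXn2r; rewrite ?nnegrE.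
        + by apply: divr_ge0 => //; exact: ltW.
        + by apply: divr_ge0; [exact: mulr_ge0|exact: addr_ge0].
        rewrite add0r; have -> : 2 * (M * B) / (1 + nu) = M * B * (2 / (1 + nu)) by ring.
        rewrite ler_wpM2l// ler_pdivlMr; last lra.
        rewrite mulrC ler_pdivrMr; lra.
    apply: (@le_trans _ _ (2 * C')).
      apply: normc_cint_bound => t It.
        by apply: ccontM; [exact: Cbound_cont Hp It|exact: ccont_osc].
      by rewrite Normc.normcM normc_osc mulr1; exact: Cbound_le_norm Hp It.
    rewrite -mulrA -[leLHS]mulr1; apply: ler_pM => //.
    - exact: mulr_ge0.
    - by rewrite ler_wpM2r// lerDr.
    - rewrite -expr_div_n exprn_ege1// ler_pdivlMr; lra.
  rewrite ler_wpM2r ?invr_ge0 ?(ltW q0)//.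
  have -> : (h2 + 2) * C' * (2 * (M * B)) ^+ k =
      K2 * ((2 ^+ k * width k) ^+ l * M ^+ k).
    by rewrite /C' /K2 !exprMn; ring.
  by rewrite ler_wpM2l// width_scale.
Qed.

(** Here [nu] has either sign and the phase may be stationary, so [cint_osc_quadratic] is used with
    [N = 4 ^+ l], whose square is [16 ^+ l]. It asks for one derivative of [g] only, and [2 ^+ l]
    terms of size [4^-1 ^+ l] give [2^-1 ^+ l]. The remainder is estimated by its supremum. *)
Lemma factor_C1_bound f k : flat12 f -> exists2 K : R, 0 <= K &
  forall l be nu g g' Kg, (forall t, I12 t -> cder g t (g' t)) ->
  (forall t, I12 t -> ccont g' t) -> (forall t, I12 t -> normc (g t) <= Kg) ->
  (forall t, I12 t -> normc (g' t) <= Kg) ->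
  normc (cint (fun t => f t * g t * (factor k l be t - 1) * osc 0 nu 0 t)) <=
    K * 2^-1 ^+ l * Kg.
Proof.
move=> Hf; have [C C0 H1] := Hf 1%N.
have [B [K [B1 K0 HR]]] := @Cbound_remainder R k.
exists (26 * C + 2 * (C * K)); first by rewrite addr_ge0 ?mulr_ge0.
move=> l be nu g g' Kg hg cg' bg bg'.
have cg t : I12 t -> ccont g t by move=> It; exact: cder_cont (hg t It).
have Kg0 : 0 <= Kg.
  by apply: le_trans (normc_ge0 (g 1)) (bg _ _); rewrite /= in_itv /= lexx ler1n.
have [f1 /(_ isT) [e1 e2] [f' [df Hf']]] := H1.
have {}Hf' : Cbound I12 true 0 1 (C * 1) f' by exact: Hf'.
have cf t : I12 t -> ccont f t by move=> It; exact: Cbound_cont H1 It.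
have cf' t : I12 t -> ccont f' t by move=> It; exact: Cbound_cont Hf' It.
have bf' t : I12 t -> normc (f' t) <= C.
  by move=> It; have := Cbound_le_norm Hf' It; rewrite mulr1.
have -> : (26 * C + 2 * (C * K)) * 2^-1 ^+ l * Kg =
    2 ^+ l * (13 * (2 * (C * Kg)) / 4 ^+ l) + 2 * (C * Kg * (K * 2^-1 ^+ l)).
  have -> : (4 : R) ^+ l = 2 ^+ l * 2 ^+ l by rewrite -exprMn; congr (_ ^+ _); ring.
  rewrite exprVn; field; exact: expf_neq0.
apply: (@cint_factor_bound _ (fun t => f t * g t)).
- by move=> t It; apply: ccontM; [exact: cf|exact: cg].
- by rewrite divr_ge0 ?mulr_ge0 ?exprn_ge0.
- move=> m; apply: (@cint_osc_quadratic _ (fun t => f t * g t)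
    (fun t => f' t * g t + f t * g' t)).
  + by move=> t It; apply: cderM; [exact: df|exact: hg].
  + by move=> t It; apply: ccontD; apply: ccontM; [exact: cf'|exact: cg|exact: cf|exact: cg'].
  + move=> t It; rewrite Normc.normcM.
    apply: (@le_trans _ _ (C * Kg)); last by rewrite ler_peMl ?mulr_ge0// ler1n.
    by apply: ler_pM; rewrite ?normc_ge0//; [exact: f1|exact: bg].
  + move=> t It; apply: le_trans (ler_normcD _ _) _; rewrite mulr_natl mulr2n.
    rewrite !Normc.normcM; apply: lerD; apply: ler_pM; rewrite ?normc_ge0//.
    * exact: bf'.
    * exact: bg.
    * exact: f1.
    * exact: bg'.
  + by rewrite e1 mul0r.
  + by rewrite e2 mul0r.
  + exact: exprn_gt0.
  + rewrite -exprM mulnC exprM.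
    have -> : (4 : R) ^+ 2 = 16 by ring.
    by rewrite ler_peMl ?exprn_ge0// ler1n.
- apply: normc_cint_bound => t It.
    apply: ccontM; last exact: ccont_osc.
    apply: ccontM; last exact: Cbound_cont (HR l be) It.
    by apply: ccontM; [exact: cf|exact: cg].
  rewrite 3!Normc.normcM normc_osc mulr1; apply: ler_pM; rewrite ?normc_ge0 ?mulr_ge0 ?normc_ge0//.
    by apply: ler_pM; rewrite ?normc_ge0//; [exact: f1|exact: bg].
  apply: le_trans (Cbound_le_norm (HR l be) It) _.
  by rewrite ler_wpM2l// width_le.
Qed.

(** The order of quantifiers matters. One [l] serves every [be], so the phase can be chosen
    afterwards by measure; it also serves every weight [g], because the weights used later depend on
    a point [t0] that runs over a continuum. *)
Lemma factor_step f k (e : R) : flat12 f -> 0 < e -> exists l, forall be,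
  (forall nu, 0 <= nu ->
    normc (cint (fun t => f t * (factor k l be t - 1) * osc 0 nu 0 t)) <= e / (1 + nu) ^+ k) /\
  (forall nu g g' Kg, (forall t, I12 t -> cder g t (g' t)) ->
    (forall t, I12 t -> ccont g' t) -> (forall t, I12 t -> normc (g t) <= Kg) ->
    (forall t, I12 t -> normc (g' t) <= Kg) ->
    normc (cint (fun t => f t * g t * (factor k l be t - 1) * osc 0 nu 0 t)) <= e * Kg).
Proof.
move=> Hf e0; have [K1 K10 H1] := factor_negative_bound k Hf.
have [K2 K20 H2] := factor_C1_bound k Hf.
have [l Hl] := half_pow_small (addr_ge0 K10 K20) e0.
have p0 : 0 <= 2^-1 ^+ l :> R by rewrite exprn_ge0// invr_ge0.
exists l => be; split.
- move=> nu nu0; apply: le_trans (H1 l be nu nu0) _.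
  rewrite ler_wpM2r ?invr_ge0 ?exprn_ge0 ?addr_ge0//.
  by apply: le_trans Hl; rewrite ler_wpM2r// lerDl.
- move=> nu g g' Kg hg cg' bg bg'.
  have Kg0 : 0 <= Kg.
    by apply: le_trans (normc_ge0 (g 1)) (bg _ _); rewrite /= in_itv /= lexx ler1n.
  apply: le_trans (H2 l be nu g g' Kg hg cg' bg bg') _.
  by rewrite ler_wpM2r//; apply: le_trans Hl; rewrite ler_wpM2r// lerDr.
Qed.

End FactorEstimates.

(** * Dead zones and the choice of the phase *)

Section DeadZones.
Context {R : realType}.
Implicit Types (x s be : R) (k l : nat).

Notation mu := (@lebesgue_measure R).

Lemma oneB_cos_le x : 0 <= x -> 1 - cos x <= x ^+ 2.
Proof.
rewrite le_eqVlt => /predU1P[<-|x0]; first by rewrite cos0 subrr sqr_ge0.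
have sinx (c : R) : 0 < c -> `|sin c| <= c.
  move=> c0; have [|d _] := @MVT R sin cos 0 c c0 (fun y _ => is_derive_sin y).
    by apply: continuous_subspaceT; exact: continuous_sin.
  rewrite sin0 !subr0 => ->; rewrite normrM (gtr0_norm c0).
  by rewrite ler_piMl ?(ltW c0)// cos_max.
have [|c] := @MVT R cos (fun y => - sin y) 0 x x0 (fun y _ => is_derive_cos y).
  by apply: continuous_subspaceT; exact: continuous_cos.
rewrite in_itv /= => /andP[c0 cx]; rewrite cos0 subr0 => H.
have := sinx _ c0; have := ler_norm (sin c); nra.
Qed.

Lemma cosD2pi_int s (z : int) : cos (s + 2 * pi * z%:~R) = cos s.
Proof.
have H (n : nat) (y : R) : cos (y + 2 * pi * n%:R) = cos y.
  elim: n => [|n IH]; first by rewrite mulr0 addr0.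
  rewrite -(natr1 n) (mulrDr (2 * pi)) mulr1 addrA -[RHS]IH.
  by rewrite -[RHS]cosD2pi (mulr_natl pi 2).
case: z => n; first exact: H.
rewrite NegzE mulrNz mulrN -(H n.+1); congr cos.
by rewrite subrK.
Qed.

(** The number of equally spaced phases: as 2 pi < 8, the spacing is below 2^-(5k+4), whose square
    2^-(10k+8) is less than [dead k]. *)
Definition nphases k : nat := (2 ^ (5 * k + 7))%N.

Lemma nphases_gt0 k : (0 < nphases k)%N. Proof. by rewrite expn_gt0. Qed.

Definition phase k (i : nat) : R := 2 * pi * i%:R / (nphases k)%:R.

(** Some shift brings [s] into [0, q) modulo 2 pi, where [q] is the spacing of the phases, and there
    1 - cos is at most q^2. *)
Lemma phase_cover k s :
  exists2 i, (i < nphases k)%N & 1 - cos (s + phase k i) < dead k.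
Proof.
have Q0 : 0 < (nphases k)%:R :> R by rewrite ltr0n nphases_gt0.
have p0 : 0 < pi :> R by exact: pi_gt0.
pose q : R := 2 * pi / (nphases k)%:R.
have q0 : 0 < q by rewrite divr_gt0// mulr_gt0.
pose z := Num.floor (s / q); pose r := s - q * z%:~R.
have /andP[z1 z2] := floor_itv (s / q); rewrite -/z in z1 z2.
have r0 : 0 <= r by rewrite subr_ge0 mulrC -ler_pdivlMr.
have rq : r < q.
  move: z2; rewrite ltr_pdivrMr// intrD mulrDl mul1r => z2.
  by rewrite /r ltrBlDl mulrC.
(* As [s = r + q * z], the shift by [q * i] with [i] congruent to [- z] modulo [nphases k] leaves
   [r] up to a multiple of 2 pi. *)
pose i := `|((- z) %% (nphases k : int))%Z|%N.
have Qn0 : (nphases k : int) != 0 by have := nphases_gt0 k; rewrite /nphases; lia.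
have iE : (i : int) = ((- z) %% (nphases k : int))%Z.
  by rewrite /i gez0_abs// modz_ge0.
exists i.
  by rewrite -ltz_nat iE; apply: ltz_pmod; rewrite ltz_nat nphases_gt0.
have -> : s + phase k i = r + 2 * pi * (- ((- z) %/ (nphases k : int))%Z)%:~R.
  have := divz_eq (- z) (nphases k); rewrite -iE; set w := (_ %/ _)%Z => E.
  have E' : i%:R = - z%:~R - w%:~R * (nphases k)%:R :> R.
    have -> : i%:R = (i : int)%:~R :> R by [].
    have -> : (nphases k)%:R = (nphases k : int)%:~R :> R by [].
    by rewrite -intrM -mulrNz -intrB E addrC addKr.
  rewrite /phase E' /r /q mulrNz; field; exact: lt0r_neq0.
rewrite cosD2pi_int; apply: le_lt_trans (oneB_cos_le r0) _.
have q8 : q < 2^-1 ^+ (5 * k + 4).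
  rewrite /q ltr_pdivrMr// /nphases natrX.
  rewrite (_ : 5 * k + 7 = (5 * k + 4) + 3)%N; last by lia.
  rewrite (exprD _ (5 * k + 4) 3) mulrA -exprMn mulVf ?pnatr_eq0// expr1n mul1r.
  by have := pihalf_lt2 R; rewrite !exprS expr0; lra.
apply: (@lt_le_trans _ _ ((2^-1 ^+ (5 * k + 4)) ^+ 2)).
  rewrite ltrXn2r// ?nnegrE// ?exprn_ge0 ?invr_ge0//.
  exact: lt_trans rq q8.
rewrite /dead -exprM (_ : (5 * k + 4) * 2 = (10 * k + 7) + 1)%N; last by lia.
by rewrite (exprD _ _ 1) ler_piMr ?exprn_ge0 ?invr_ge0// expr1 invf_le1// ler1n.
Qed.

Lemma continuous_vercos M be : continuous (vercos M be).
Proof.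
move=> t; have := ccontD (ccont_cst 1 t) (ccontM (ccont_cst (-1) t) (ccont_osc M 0 be t)).
move=> [H _]; rewrite /continuous_at.
have -> : vercos M be = (fun x => complex.Re (1 + (-1) * osc M 0 be x)).
  by apply/funext => x; rewrite mulN1r.
exact: H.
Qed.

(** The inequality is weak to make this set closed: a point that leaves it has a whole neighbourhood
    on which the factor vanishes. *)
Definition alive k l be : set R := [set t | dead k <= vercos (16 ^+ l) be t].

Lemma closed_alive k l be : closed (alive k l be).
Proof.
apply: (@preimage_closed _ _ (vercos (16 ^+ l) be) [set x | dead k <= x]).
  by move=> x _; exact: continuous_vercos.
exact: closed_ge.
Qed.

(** By [phase_cover], the parts of [K] killed by the [nphases k] phases cover [K], so one of them
    has at least the average measure. *)
Lemma phase_pigeonhole k l (K : set R) : measurable K -> (mu K < +oo)%E ->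
  exists i, (fine (mu (K `&` alive k l (phase k i))) <=
             (1 - (nphases k)%:R^-1) * fine (mu K)).
Proof.
move=> mK fK; apply: contrapT => /forallNP H.
have Q0 : 0 < (nphases k)%:R :> R by rewrite ltr0n nphases_gt0.
have ma i : measurable (alive k l (phase k i)).
  by apply: closed_measurable; exact: closed_alive.
have fin A : measurable A -> A `<=` K -> mu A \is a fin_num.
  move=> mA AK; rewrite ge0_fin_numE//; apply: le_lt_trans fK.
  by apply: le_measure => //; rewrite inE.
pose D i := K `\` alive k l (phase k i).
have mD i : measurable (D i) by exact: measurableD.
have Dlt i : fine (mu (D i)) < (nphases k)%:R^-1 * fine (mu K).
  have := measureDI mu mK (ma i) => E.
  have fD : mu (D i) \is a fin_num by apply: fin => // x [].
  have fI : mu (K `&` alive k l (phase k i)) \is a fin_num.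
    by apply: fin; [exact: measurableI|move=> x []].
  have := H i => /negP; rewrite -ltNge E fineD//.
  rewrite -/(D i); lra.
have cov : K `<=` \big[setU/set0]_(i < nphases k) D i.
  move=> t Kt; have [i iQ c] := phase_cover k (16 ^+ l * t ^+ 2).
  rewrite -bigcup_mkord; exists i => //; split => // /=.
  rewrite /alive /= vercosE; apply/negP; rewrite -ltNge.
  exact: c.
have mU : measurable (\big[setU/set0]_(i < nphases k) D i).
  by apply: bigsetU_measurable => i _.
have : (mu K <= \sum_(i < nphases k) mu (D i))%E.
  apply: le_trans (Boole_inequality mu (fun i _ => mD i)).
  by apply: le_measure => //; rewrite inE.
have fK' : mu K \is a fin_num by apply: fin.
rewrite -(fineK fK').
under eq_bigr do rewrite -(fineK (fin _ (mD _) (fun x (h : (K `\` _) x) => h.1))).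
rewrite sumEFin lee_fin leNgt => /negP; apply.
apply: (@lt_le_trans _ _ (\sum_(i < nphases k) ((nphases k)%:R^-1 * fine (mu K)))).
  case: (nphases k) (nphases_gt0 k) Dlt => // n _ Dlt.
  by apply: ltr_sum => //; apply/hasP; exists ord0; rewrite ?mem_index_enum.
by rewrite sumr_const card_ord -[leLHS]mulr_natl mulrA divff ?gt_eqF// mul1r.
Qed.

End DeadZones.

(** * The inductive construction of the stages *)

Section Construction.
Context {R : realType}.

Notation normc := (@Normc.normc R).
Notation mu := (@lebesgue_measure R).
Notation I12 := (`[1, 2]%classic : set R).

(** The largest [k] with [2 ^ (5 * k + 7) <= j + 128]. It tends to infinity, yet so slowly that step
    [j] removes a proportion of at least [1 / (j + 128)], a divergent series; 128 is [nphases 0]. *)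
Definition order (j : nat) : nat := ((trunc_log 2 (j + 128) - 7) %/ 5)%N.

Lemma nphases_order j : (nphases (order j) <= j + 128)%N.
Proof.
have H : (7 <= trunc_log 2 (j + 128))%N.
  by apply: trunc_log_max => //; rewrite leq_addl.
apply: leq_trans (trunc_logP (ltnSn 1) (ltn_addl j (ltn0Sn 127))).
rewrite /nphases leq_exp2l// /order.
by have := leq_divM (trunc_log 2 (j + 128) - 7) 5; rewrite mulnC; lia.
Qed.

Lemma leq_order k : exists J, forall j, (J <= j)%N -> (k <= order j)%N.
Proof.
exists (2 ^ (5 * k + 7))%N => j Jj.
have H : (5 * k + 7 <= trunc_log 2 (j + 128))%N.
  by apply: trunc_log_max => //; rewrite (leq_trans Jj)// leq_addr.
by rewrite /order leq_divRL//; lia.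
Qed.

Record stage := Stage { sfun : R -> R[i]; sset : set R }.

(** The measure bound is the telescoping product of the ratios [1 - 1 / (i + 128)] over [i < j]. *)
Definition stage_ok (j : nat) (s : stage) := [/\ flat12 (sfun s), closed (sset s),
  sset s `<=` I12, (forall t, ~ sset s t -> sfun s t = 0) &
  fine (mu (sset s)) <= 127 / (j%:R + 127)].

(** The first estimate, for [nu >= 0] only, yields the one-sided decay. The second, for all [nu] and
    with a [C^1] weight, yields convergence of the coefficients of T and of its quotient by e^(i(t -
    t0)) - 1. *)
Definition stage_next (j : nat) (e : R) (s s' : stage) :=
  [/\ sset s' `<=` sset s,
   (forall nu, 0 <= nu ->
     normc (cint (fun t => (sfun s' t - sfun s t) * osc 0 nu 0 t)) <=
       e / (1 + nu) ^+ order j) &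
   (forall nu g g' Kg, (forall t, I12 t -> cder g t (g' t)) ->
     (forall t, I12 t -> ccont g' t) -> (forall t, I12 t -> normc (g t) <= Kg) ->
     (forall t, I12 t -> normc (g' t) <= Kg) ->
     normc (cint (fun t => (sfun s' t - sfun s t) * g t * osc 0 nu 0 t)) <= e * Kg)].

Lemma measure_sub12_fin (K : set R) : K `<=` I12 -> measurable K -> (mu K < +oo)%E.
Proof.
move=> KI mK; apply: (@le_lt_trans _ _ (mu I12)).
  by apply: le_measure => //; rewrite inE//; exact: mI12.
by rewrite lebesgue_measure_itv /= lte_fin ltr1n ltry.
Qed.

Lemma stage_step j e s : stage_ok j s -> 0 < e ->
  exists2 s', stage_ok j.+1 s' & stage_next j e s s'.
Proof.
move=> [fs cs sI s0 ms] e0.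
have [l Hl] := factor_step (order j) fs e0.
have mK : measurable (sset s) by exact: closed_measurable.
have [i Hi] := phase_pigeonhole (order j) l mK (measure_sub12_fin sI mK).
set be := phase (order j) i in Hi; have [H1 H2] := Hl be.
exists (Stage (fun t => sfun s t * factor (order j) l be t)
              (sset s `&` alive (order j) l be)); split; rewrite ?[sfun (Stage _ _)]/= ?[sset (Stage _ _)]/=.
- exact: flat12_factor.
- by apply: closedI => //; exact: closed_alive.
- by move=> t [/sI].
- move=> t /not_andP[/s0 ->|]; first by rewrite mul0r.
  move=> /negP; rewrite -ltNge => /ltW H.
  by rewrite factor_dead ?mulr0.
- apply: (le_trans Hi); set Q := nphases _.
  have Qj : (Q <= j + 128)%N by exact: nphases_order.
  have Q0 : 0 < Q%:R :> R by rewrite ltr0n nphases_gt0.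
  have N0 : 0 < (j + 128)%:R :> R by rewrite ltr0n addn_gt0 orbT.
  have j0 : 0 <= j%:R :> R by exact: ler0n.
  have Q1 : 1 <= Q%:R :> R by rewrite ler1n nphases_gt0.
  apply: (@le_trans _ _ ((1 - (j + 128)%:R^-1) * (127 / (j%:R + 127)))).
    apply: ler_pM => //.
    + by rewrite subr_ge0 invf_le1.
    + exact: fine_ge0.
    + by rewrite lerD2l lerN2 lef_pV2 ?posrE// ler_nat.
  (* The product of [1 - 1 / (j + 128)] and [127 / (j + 127)] is exactly [127 / (j.+1 + 127)]. *)
  rewrite natrD -natr1 le_eqVlt; apply/orP; left; apply/eqP.
  by field; rewrite !gt_eqF//; lra.
- by move=> t [].
- move=> nu nu0; rewrite (@eq_cint _ _ (fun t => sfun s t * (factor (order j) l be t - 1) * osc 0 nu 0 t)).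
    exact: H1.
  by move=> t _ /=; ring.
- move=> nu g g' Kg hg cg bg bg'.
  rewrite (@eq_cint _ _ (fun t => sfun s t * g t * (factor (order j) l be t - 1) * osc 0 nu 0 t)).
    exact: (H2 nu g g').
  by move=> t _ /=; ring.
Qed.

Definition stage0 : stage := Stage (fun t => (bump 0 0 t)%:C) I12.

Lemma stage0_ok : stage_ok 0 stage0.
Proof.
split => /=.
- by move=> k; exact: Cbound_bump.
- exact: itv_closed.
- by [].
- move=> t; rewrite in_itv /= => /negP; rewrite negb_and -!ltNge.
  rewrite /bump => /orP[H|H].
    by rewrite flat_le0 ?mul0r// subr_le0 ltW.
  by rewrite (@flat_le0 _ 0 (2 - t)) ?mulr0// subr_le0 ltW.
- rewrite lebesgue_measure_itv /= lte_fin ltr1n /= add0r divff//; lra.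
Qed.

Lemma stage_sequence (e : R) : 0 < e -> exists s : nat -> stage,
  [/\ s 0%N = stage0, forall j, stage_ok j (s j) &
      forall j, stage_next j (e * 2^-1 ^+ j) (s j) (s j.+1)].
Proof.
move=> e0.
have ej j : 0 < e * 2^-1 ^+ j by rewrite mulr_gt0// exprn_gt0// invr_gt0.
(* The index travels with the stage, because the admissible successors depend on it. *)
pose X := {p : nat * stage | stage_ok p.1 p.2}.
pose Rel (x y : X) := (sval y).1 = (sval x).1.+1 /\
  stage_next (sval x).1 (e * 2^-1 ^+ (sval x).1) (sval x).2 (sval y).2.
have step (x : X) : {y : X | Rel x y}.
  apply: cid; case: x => [[j s] /= ok].
  have [s' ok' nx] := stage_step ok (ej j).
  by exists (exist (fun p => stage_ok p.1 p.2) (j.+1, s') ok').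
have [f [f0 fS]] := dependent_choice step
  (exist (fun p => stage_ok p.1 p.2) (0%N, stage0) stage0_ok : X).
have fn n : (sval (f n)).1 = n.
  by elim: n => [|n IH]; [rewrite f0|rewrite (fS n).1 IH].
exists (fun n => (sval (f n)).2); split; first by rewrite f0.
- by move=> j; have := svalP (f j); rewrite fn.
- by move=> j; have := (fS j).2; rewrite fn.
Qed.

End Construction.

(** * Limits of sequences with geometric increments *)

Section GeometricLimits.
Context {R : realType}.

Notation normc := (@Normc.normc R).

(** The intervals of radius [2 * C * 2^-1 ^+ j] around [u j] are nested, and the supremum of their
    left ends lies in all of them. *)
Lemma geometric_limit (u : nat -> R) (C : R) :
  (forall j, `|u j.+1 - u j| <= C * 2^-1 ^+ j) ->
  exists w, forall j, `|w - u j| <= 2 * C * 2^-1 ^+ j.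
Proof.
move=> H; pose lo j := u j - 2 * C * 2^-1 ^+ j; pose hi j := u j + 2 * C * 2^-1 ^+ j.
have C0 : 0 <= C by have := le_trans (normr_ge0 _) (H 0%N); rewrite expr0 mulr1.
have p0 j : 0 <= 2^-1 ^+ j :> R by rewrite exprn_ge0// invr_ge0.
have step j : lo j <= lo j.+1 /\ hi j.+1 <= hi j.
  have := H j; rewrite ler_norml => /andP[h1 h2]; rewrite /lo /hi exprS.
  have -> : 2 * C * (2^-1 * 2^-1 ^+ j) = C * 2^-1 ^+ j by field.
  by split; lra.
have mlo i j : (i <= j)%N -> lo i <= lo j.
  by move=> /subnK <-; elim: (j - i)%N => [//|m IH]; apply: le_trans IH (step _).1.
have mhi i j : (i <= j)%N -> hi j <= hi i.
  by move=> /subnK <-; elim: (j - i)%N => [//|m IH]; apply: le_trans (step _).2 IH.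
have lohi i j : lo i <= hi j.
  have lh m : lo m <= hi m.
    have : 0 <= 2 * C * 2^-1 ^+ m by rewrite !mulr_ge0.
    by rewrite /lo /hi; lra.
  have [/mlo|/ltnW /mhi] := leqP i j => h; first exact: le_trans h (lh j).
  exact: le_trans (lh i) h.
have hs : has_sup (range lo).
  split; first by exists (lo 0%N), 0%N.
  by exists (hi 0%N) => _ [i _ <-].
exists (sup (range lo)) => j; rewrite ler_distl; apply/andP; split.
  by apply: sup_upper_bound => //; exists j.
by apply: ge_sup => [|_ [i _ <-]]; [exact: hs.1|exact: lohi].
Qed.

Lemma geometric_limitC (z : nat -> R[i]) (C : R) :
  (forall j, normc (z j.+1 - z j) <= C * 2^-1 ^+ j) ->
  exists w, forall j, normc (w - z j) <= 4 * C * 2^-1 ^+ j.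
Proof.
move=> H.
have hB (a b : R[i]) : complex.Re (a - b) = complex.Re a - complex.Re b /\
    complex.Im (a - b) = complex.Im a - complex.Im b by case: a; case: b.
have [|x Hx] := @geometric_limit (fun j => complex.Re (z j)) C.
  by move=> j; rewrite -(hB _ _).1; exact: le_trans (normr_Re_le _) (H j).
have [|y Hy] := @geometric_limit (fun j => complex.Im (z j)) C.
  by move=> j; rewrite -(hB _ _).2; exact: le_trans (normr_Im_le _) (H j).
exists (Complex x y) => j; apply: le_trans (normc_le_ReIm _) _.
rewrite (hB _ _).1 (hB _ _).2 [complex.Re (Complex _ _)]/= [complex.Im (Complex _ _)]/=.
by have := lerD (Hx j) (Hy j); lra.
Qed.

(** Used to let the error tend to 0 after limit coefficients have been compared with those of a
    stage. *)
Lemma geometric_small (x C D : R) J : 0 <= C ->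
  (forall j, (J <= j)%N -> x <= C * 2^-1 ^+ j + D) -> x <= D.
Proof.
move=> C0 H; apply/ler_addgt0Pr => e e0.
have [l Hl] := half_pow_small C0 e0.
apply: le_trans (H (J + l)%N (leq_addr _ _)) _; rewrite addrC lerD2l.
apply: le_trans Hl; rewrite ler_wpM2l// exprD ler_piMl ?exprn_ge0 ?invr_ge0//.
by rewrite exprn_ile1 ?invr_ge0// invf_le1// ler1n.
Qed.

End GeometricLimits.

(** * Division by e^(i(t - t0)) - 1 away from t0 *)

Section LocalDivisor.
Context {R : realType} (t0 de : R) (de0 : 0 < de).

Notation normc := (@Normc.normc R).

(** [y t] is |e^(i(t - t0)) - 1|^2. The [flat] term added in [d] vanishes where [de <= y t] and
    keeps [d] above [dmin] elsewhere, so dividing the conjugate of e^(i(t - t0)) - 1 by [d] is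
    harmless at [t0]. *)
Let y t : R := 2 - 2 * cos (t - t0).
Let d t : R := y t + flat 0 (de - y t).
Let dmin : R := Num.min (de / 2) (flat 0 (de / 2)).

(* A smooth function equal to [1 / (cis (t - t0) - 1)] away from [t0]. *)
Definition recip t : R[i] := (cis (t0 - t) - 1) * (d t)^-1%:C.

Let y_ge0 t : 0 <= y t.
Proof. by rewrite /y; have := cos_le1 (t - t0); lra. Qed.

Let dmin_gt0 : 0 < dmin.
Proof. by rewrite lt_min flat_gt0 divr_gt0. Qed.

Let d_ge t : dmin <= d t.
Proof.
rewrite /dmin ge_min /d; have y0 := y_ge0 t.
have [h|h] := leP (de / 2) (y t).
  by apply/orP; left; have := flat_ge0 0 (de - y t); lra.
apply/orP; right; have : flat 0 (de / 2) <= flat 0 (de - y t) by apply: flat0_homo; lra.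
lra.
Qed.

Lemma recip_mul t : de <= 2 - 2 * cos (t - t0) -> recip t * (cis (t - t0) - 1) = 1.
Proof.
move=> h; have dE : d t = y t by rewrite /d flat_le0 ?addr0// subr_le0.
have y0 : y t != 0 by rewrite gt_eqF// (lt_le_trans de0).
rewrite /recip dE mulrAC.
have -> : (cis (t0 - t) - 1) * (cis (t - t0) - 1) = (y t)%:C.
  have e : cis (t0 - t) * cis (t - t0) = 1 by rewrite -cisD addrC subrKA subrr cis0.
  have -> : (cis (t0 - t) - 1) * (cis (t - t0) - 1) =
    cis (t0 - t) * cis (t - t0) + 1 - (cis (t0 - t) + cis (t - t0)) by ring.
  rewrite e -[t0 - t]opprB; apply: complex_ext; rewrite /cis /y /= ?cosN ?sinN; ring.
by rewrite -rmorphM /= divff.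
Qed.

Lemma recip_C1 : exists g' (K : R), [/\ forall t, cder recip t (g' t),
  forall t, ccont g' t, forall t, normc (recip t) <= K & forall t, normc (g' t) <= K].
Proof.
have du t : is_derive t (1 : R) (fun x => x - t0) 1.
  have H := is_deriveB (is_derive_id t (1 : R)) (is_derive_cst t0 t (1 : R)).
  by apply: (is_derive_eq H); rewrite subr0.
have dv t : is_derive t (1 : R) (fun x => t0 - x) (- 1).
  have H := is_deriveB (is_derive_cst t0 t (1 : R)) (is_derive_id t (1 : R)).
  by apply: (is_derive_eq H); rewrite sub0r.
have dy t : is_derive t (1 : R) y (2 * sin (t - t0)).
  have H1 := @is_derive1_comp _ cos (fun x => x - t0) _ _ _ (is_derive_cos _) (du t).
  have H2 := is_deriveM (is_derive_cst (2 : R) t (1 : R)) H1.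
  have H := is_deriveB (is_derive_cst (2 : R) t (1 : R)) H2.
  by apply: (is_derive_eq H); rewrite /GRing.scale /=; ring.
(* The derivative of [flat 0] is [flat 2], by [is_derive_flat] at [m = 0]; it is at most 2! = 2,
   whence the bound 2 + 2 * 2 = 6 for [d'] below. *)
pose d' t := 2 * sin (t - t0) + flat 2 (de - y t) * (- (2 * sin (t - t0))).
have dd t : is_derive t (1 : R) d (d' t).
  have H1 : is_derive t (1 : R) (fun x => de - y x) (0 - 2 * sin (t - t0)).
    exact: (is_deriveB (is_derive_cst de t (1 : R)) (dy t)).
  have H2 := @is_derive1_comp _ (flat 0) (fun x => de - y x) _ _ _ (is_derive_flat 0 _) H1.
  have H := is_deriveD (dy t) H2.
  by apply: (is_derive_eq H); rewrite /d' mul0r subr0 sub0r.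
have d0 t : 0 < d t by exact: lt_le_trans dmin_gt0 (d_ge t).
have di t : is_derive t (1 : R) (fun x => (d x)^-1) (- (d t)^-1 ^+ 2 * d' t).
  have H := is_deriveV (lt0r_neq0 (d0 t)) (dd t).
  by apply: (is_derive_eq H); rewrite /GRing.scale /= exprVn.
have cdi t : continuous_at t (fun x => (d x)^-1) by exact: is_derive_cont (di t).
have cs t : continuous_at t (fun x => sin (x - t0)).
  have H1 := @is_derive1_comp _ sin (fun x => x - t0) _ _ _ (is_derive_sin _) (du t).
  exact: is_derive_cont H1.
have cd' t : continuous_at t d'.
  have c1 : continuous_at t (fun x => 2 * sin (x - t0)).
    by apply: cont_atM; [exact: cont_at_cst|exact: cs].
  apply: cont_atD => //; apply: cont_atM; last exact: (continuousN c1).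
  have H1 : is_derive t (1 : R) (fun x => de - y x) (0 - 2 * sin (t - t0)).
    exact: (is_deriveB (is_derive_cst de t (1 : R)) (dy t)).
  have H2 := @is_derive1_comp _ (flat 2) (fun x => de - y x) _ _ _ (is_derive_flat 2 _) H1.
  exact: is_derive_cont H2.
pose g' t : R[i] := 'i * (- 1)%:C * cis (t0 - t) * (d t)^-1%:C +
  (cis (t0 - t) - 1) * (- (d t)^-1 ^+ 2 * d' t)%:C.
have dc t : cder (fun x => cis (t0 - x) - 1) t ('i * (- 1)%:C * cis (t0 - t)).
  apply: cder_eq (cderD (@cder_cis _ (fun x => t0 - x) _ _ (dv t)) (cder_cst (-1) t)) _.
  by rewrite addr0.
have iM t : 0 <= (d t)^-1 <= dmin^-1.
  by rewrite invr_ge0 (ltW (d0 t)) lef_pV2 ?posrE ?d_ge ?dmin_gt0 ?d0.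
have M0 : 0 <= dmin^-1 by rewrite invr_ge0 ltW.
have n2 t : normc (cis (t0 - t) - 1) <= 2.
  apply: le_trans (ler_normcB _ _) _; rewrite normc_cis Normc.normc1; lra.
have nd' t : `|d' t| <= 6.
  have := sin_max (t - t0); have := flat_ge0 2 (de - y t).
  have : flat 2 (de - y t) <= 2 := flat_bound 2 _.
  rewrite /d' !ler_norml => f2 f0 /andP[s1 s2]; apply/andP; split; nra.
exists g', (2 * dmin^-1 + 12 * dmin^-1 ^+ 2); split.
- by move=> t; apply: cderM => //; exact: cder_real.
- have ccr (v : R -> R) t : continuous_at t v -> ccont (fun x => (v x)%:C) t.
    by move=> cv; split => //=; exact: cont_at_cst.
  have cc t : ccont (fun x => cis (t0 - x)) t.
    exact: cder_cont (@cder_cis _ (fun x => t0 - x) _ _ (dv t)).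
  move=> t; apply: ccontD.
    by apply: ccontM; [apply: ccontM; [exact: ccont_cst|exact: cc]|exact: ccr].
  apply: ccontM; first exact: cder_cont (dc t).
  apply: ccr; apply: cont_atM => //.
  have -> : (fun x => - (d x)^-1 ^+ 2) = (fun x => (- 1) * ((d x)^-1 * (d x)^-1)).
    by apply/funext => x; rewrite mulN1r expr2.
  by apply: cont_atM; [exact: cont_at_cst|exact: cont_atM].
- move=> t; have /andP[i0 i1] := iM t.
  rewrite Normc.normcM normc_real ger0_norm//.
  apply: (@le_trans _ _ (2 * dmin^-1)); first by apply: ler_pM; rewrite ?normc_ge0.
  by rewrite lerDl mulr_ge0// exprn_ge0.
- move=> t; have /andP[i0 i1] := iM t; apply: le_trans (ler_normcD _ _) _.
  apply: lerD.
    rewrite 3!Normc.normcM normc_i mul1r !normc_real normc_cis normrN normr1 mulr1 mul1r.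
    rewrite ger0_norm//; lra.
  rewrite Normc.normcM normc_real normrM normrN (@ger0_norm _ ((d t)^-1 ^+ 2)) ?exprn_ge0//.
  have h : (d t)^-1 ^+ 2 <= dmin^-1 ^+ 2 by rewrite lerXn2r ?nnegrE.
  apply: (@le_trans _ _ (2 * (dmin^-1 ^+ 2 * 6))); last lra.
  apply: ler_pM; rewrite ?normc_ge0 ?mulr_ge0 ?exprn_ge0//.
  by apply: ler_pM; rewrite ?exprn_ge0.
Qed.

End LocalDivisor.

(** * Fourier coefficients of the limit distribution *)

Section NullSeries.
Context {R : realType} (e : R) (e0 : 0 < e) (s : nat -> @stage R)
  (s_ok : forall j, stage_ok j (s j))
  (s_next : forall j, stage_next j (e * 2^-1 ^+ j) (s j) (s j.+1)).

Notation normc := (@Normc.normc R).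
Notation mu := (@lebesgue_measure R).
Notation I12 := (`[1, 2]%classic : set R).

Definition C1bound (g : R -> R[i]) (K : R) := exists g',
  [/\ forall t, I12 t -> cder g t (g' t), forall t, I12 t -> ccont g' t,
      forall t, I12 t -> normc (g t) <= K & forall t, I12 t -> normc (g' t) <= K].

(** The unnormalized Fourier coefficient of index [- nu] of stage [j] weighted by [g], with [nu]
    allowed to be real. *)
Definition coef (g : R -> R[i]) (j : nat) (nu : R) : R[i] :=
  cint (fun t => sfun (s j) t * g t * osc 0 nu 0 t).

Lemma C1bound_ge0 g K : C1bound g K -> 0 <= K.
Proof.
move=> [g' [_ _ bg _]]; apply: le_trans (normc_ge0 (g 1)) (bg _ _).
by rewrite /= in_itv /= lexx ler1n.
Qed.

Lemma ccont_C1bound g K t : C1bound g K -> I12 t -> ccont g t.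
Proof. by move=> [g' [h _ _ _]] It; exact: cder_cont (h t It). Qed.

Lemma ccont_stage j t : I12 t -> ccont (sfun (s j)) t.
Proof. by move=> It; have [/(_ 0%N) [C _ H] _ _ _ _] := s_ok j; exact: Cbound_cont H It. Qed.

Lemma ccont_coef g K j nu t : C1bound g K -> I12 t ->
  ccont (fun t => sfun (s j) t * g t * osc 0 nu 0 t) t.
Proof.
move=> hg It; apply: ccontM; last exact: ccont_osc.
by apply: ccontM; [exact: ccont_stage|exact: ccont_C1bound hg It].
Qed.

(** Successive stages change the coefficient by at most [e * K * 2^-1 ^+ j], uniformly in [nu]. The
    limits are the coefficients of the distribution T multiplied by [g]. *)
Lemma coef_limit g K : C1bound g K ->
  exists q : R -> R[i], forall nu j, normc (q nu - coef g j nu) <= 4 * (e * K) * 2^-1 ^+ j.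
Proof.
move=> hg; suff /choice[q hq] : forall nu, exists z, forall j,
    normc (z - coef g j nu) <= 4 * (e * K) * 2^-1 ^+ j by exists q.
move=> nu; apply: geometric_limitC => j; have [g' [h1 h2 h3 h4]] := hg.
have [_ _ H] := s_next j; have := H nu g g' K h1 h2 h3 h4.
rewrite mulrAC; apply: le_trans; rewrite -cintB.
- by rewrite le_eqVlt; apply/orP; left; apply/eqP; congr normc; apply: eq_cint => t _; ring.
- by move=> t It; exact: ccont_coef hg It.
- by move=> t It; exact: ccont_coef hg It.
Qed.

(** By uniformity in [nu], [q] stays within [eta / 2] of the coefficients of a single stage [J], and
    these tend to 0 after one integration by parts. *)
Lemma coef_limit_to0 g K (q : R -> R[i]) : C1bound g K ->
  (forall nu j, normc (q nu - coef g j nu) <= 4 * (e * K) * 2^-1 ^+ j) ->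
  forall eta, 0 < eta -> exists N : R, forall nu, N <= `|nu| -> normc (q nu) <= eta.
Proof.
move=> hg hq eta eta0; have K0 := C1bound_ge0 hg.
have h0 : 0 <= 4 * (e * K) by rewrite !mulr_ge0// ltW.
have eta2 : 0 < eta / 2 by rewrite divr_gt0.
have [J HJ] := half_pow_small h0 eta2.
have [/(_ 1%N) [C C0 H1] _ _ _ _] := s_ok J.
have [f1 /(_ isT) [z1 z2] [f' [df Hf']]] := H1.
have {}Hf' : Cbound I12 true 0 1 (C * 1) f' by exact: Hf'.
have [g' [h1 h2 h3 h4]] := hg.
pose L := C * 1 * K + C * K.
have L0 : 0 <= L by rewrite addr_ge0// !mulr_ge0.
exists (4 * L / eta + 1) => nu hnu.
have nu0 : 0 < `|nu|.
  apply: lt_le_trans hnu; apply: ltr_wpDl => //.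
  by rewrite divr_ge0 ?mulr_ge0// ltW.
have HA : normc (coef g J nu) <= 2 * L / `|nu|.
  apply: (@cint_osc_linear _ (fun t => sfun (s J) t * g t)
    (fun t => f' t * g t + sfun (s J) t * g' t)).
  - by move=> t It; apply: cderM; [exact: df|exact: h1].
  - move=> t It; apply: ccontD; apply: ccontM.
    + exact: Cbound_cont Hf' It.
    + exact: ccont_C1bound hg It.
    + exact: ccont_stage.
    + exact: h2.
  - move=> t It; apply: le_trans (ler_normcD _ _) _; rewrite !Normc.normcM.
    apply: lerD; apply: ler_pM; rewrite ?normc_ge0//.
    + exact: Cbound_le_norm Hf' It.
    + exact: h3.
    + exact: f1.
    + exact: h4.
  - by rewrite z1 mul0r.
  - by rewrite z2 mul0r.
  - by rewrite -normr_gt0.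
have -> : q nu = (q nu - coef g J nu) + coef g J nu by rewrite subrK.
apply: le_trans (ler_normcD _ _) _; rewrite [leRHS]splitr; apply: lerD.
  exact: le_trans (hq nu J) HJ.
apply: (le_trans HA); rewrite ler_pdivrMr//.
have : 4 * L / eta <= `|nu| by rewrite (le_trans _ hnu)// lerDl.
rewrite ler_pdivrMr// => h; lra.
Qed.

Lemma C1bound1 : C1bound (fun=> 1) 1.
Proof.
exists (fun=> 0); split => t _.
- exact: cder_cst.
- exact: ccont_cst.
- by rewrite Normc.normc1.
- by rewrite Normc.normc0.
Qed.

(** From some [J] on, [order j] is at least [k] and the increments decay like nu^(-k) with summable
    constants; stage [J] itself is one smooth function. *)
Lemma coef_limit_decay (q : R -> R[i]) k :
  (forall nu j, normc (q nu - coef (fun=> 1) j nu) <= 4 * (e * 1) * 2^-1 ^+ j) ->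
  exists2 C : R, 0 <= C & forall nu, 0 < nu -> normc (q nu) <= C / nu ^+ k.
Proof.
move=> hq; have [J HJ] := leq_order k.
have [/(_ k) [C C0 HC] _ _ _ _] := s_ok J.
have [H H0 HN] := @cint_osc_nonstationary R k.
have h0 : 0 <= 4 * (e * 1) by rewrite !mulr_ge0// ltW.
exists (H * C + 2 * e); first by rewrite addr_ge0 ?mulr_ge0// ltW.
move=> nu nu0; have nup : 0 < 0 + nu by rewrite add0r.
have p0 : 0 < nu ^+ k by exact: exprn_gt0.
have e1 j : (J <= j)%N ->
    normc (coef (fun=> 1) j.+1 nu - coef (fun=> 1) j nu) <= e * 2^-1 ^+ j / nu ^+ k.
  move=> Jj; have [_ h _] := s_next j; have := h nu (ltW nu0) => {}h.
  rewrite -cintB; first last.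
  - by move=> t It; exact: ccont_coef C1bound1 It.
  - by move=> t It; exact: ccont_coef C1bound1 It.
  rewrite (@eq_cint _ _ (fun t => (sfun (s j.+1) t - sfun (s j) t) * osc 0 nu 0 t)); last first.
    by move=> t _; ring.
  apply: (le_trans h); rewrite ler_wpM2l ?mulr_ge0 ?exprn_ge0 ?invr_ge0 ?(ltW e0)//.
  rewrite lef_pV2 ?posrE ?exprn_gt0 ?addr_gt0//.
  apply: (@le_trans _ _ ((1 + nu) ^+ k)).
    by rewrite lerXn2r ?nnegrE ?addr_ge0 ?(ltW nu0)// lerDr.
  by rewrite ler_weXn2l ?HJ// lerDl ltW.
(* The partial geometric sum is kept in closed form so that the induction on [j - J] goes
   through. *)
have e2 j : (J <= j)%N ->
    normc (coef (fun=> 1) j nu - coef (fun=> 1) J nu) <=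
      (2 * e - 2 * e * 2^-1 ^+ (j - J)) / nu ^+ k.
  move=> /subnK <-; rewrite addnK; elim: (j - J)%N => [|m IH].
    by rewrite add0n subrr Normc.normc0 expr0 mulr1 subrr mul0r.
  rewrite addSn -(subrKA (coef (fun=> 1) (m + J) nu)).
  apply: le_trans (ler_normcD _ _) _.
  apply: le_trans (lerD (e1 (m + J)%N (leq_addl _ _)) IH) _.
  rewrite -mulrDl ler_wpM2r ?invr_ge0 ?(ltW p0)// exprS exprD.
  have j0 : 0 <= 2^-1 ^+ m :> R by rewrite exprn_ge0// invr_ge0.
  have J1 : 2^-1 ^+ J <= 1 :> R by rewrite exprn_ile1 ?invr_ge0// invf_le1// ler1n.
  have : e * (2^-1 ^+ m * 2^-1 ^+ J) <= e * (2^-1 ^+ m * 1).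
    by rewrite ler_wpM2l ?(ltW e0)// ler_wpM2l.
  lra.
have e3 : normc (q nu - coef (fun=> 1) J nu) <= 2 * e / nu ^+ k.
  apply: (@geometric_small _ _ _ _ J h0) => j Jj.
  rewrite -(subrKA (coef (fun=> 1) j nu)); apply: le_trans (ler_normcD _ _) _.
  apply: lerD; first exact: hq.
  apply: le_trans (e2 j Jj) _; rewrite ler_wpM2r ?invr_ge0 ?(ltW p0)//.
  by rewrite gerBl !mulr_ge0 ?exprn_ge0 ?invr_ge0// ltW.
have -> : q nu = coef (fun=> 1) J nu + (q nu - coef (fun=> 1) J nu) by rewrite addrC subrK.
apply: le_trans (ler_normcD _ _) _; rewrite mulrDl; apply: lerD => //.
rewrite /coef (@eq_cint _ _ (fun t => sfun (s J) t * osc 0 nu 0 t)); last first.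
  by move=> t _; rewrite mulr1.
apply: le_trans (HN _ 1 C 0 nu 0 (lexx 1) C0 (lexx 0) (ltW nu0) nup HC) _.
by rewrite add0r mul1r exprVn.
Qed.

Lemma stage_subset i j : (i <= j)%N -> sset (s j) `<=` sset (s i).
Proof.
move=> /subnK <-; elim: (j - i)%N => [//|m IH]; rewrite addSn.
by have [h _ _] := s_next (m + i)%N; exact: subset_trans h IH.
Qed.

(** The sets decrease, so a ball around [t0] that misses [sset (s j)] misses all later ones. The
    distance must be taken on the circle, hence the cosine. *)
Lemma stage_far t0 j : t0 \in `[0, 2 * pi] -> ~ sset (s j) t0 ->
  exists2 de, 0 < de & forall i t, (j <= i)%N ->
    sfun (s i) t = 0 \/ de <= 2 - 2 * cos (t - t0).
Proof.
rewrite in_itv /= => /andP[t00 t01] nK.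
have [_ cK KI _ _] := s_ok j.
have /nbhs_ballP[r /= r0 rK] : nbhs t0 (~` sset (s j)).
  by apply: open_nbhs_nbhs; split => //; exact: closed_openC.
(* The radius is capped at 1: for [t] in [1, 2] and [t0] in [0, 2 pi] one has |t - t0| <= 2 pi - 1
   <= 2 pi - r', so going around the circle brings the points no closer than [r']. *)
pose r' := Num.min r 1; have r'0 : 0 < r' by rewrite lt_min r0 ltr01.
have r'1 : r' <= 1 by rewrite ge_min lexx orbT.
have pi2 : 2 <= pi :> R by exact: pi_ge2.
exists (2 - 2 * cos r').
  have : cos r' < cos 0 by rewrite ltr_cos// in_itv /=; apply/andP; split; lra.
  rewrite cos0; lra.
move=> i t ji.
have [Kt|nKt] := pselect (sset (s i) t); last first.
  by left; have [_ _ _ h _] := s_ok i; exact: h.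
right; have Kjt := stage_subset ji Kt.
have /andP[t1 t2] : 1 <= t <= 2 by have := KI _ Kjt; rewrite /= in_itv.
have tr : r' <= `|t - t0|.
  rewrite leNgt; apply/negP => h; apply: (rK t) => //.
  rewrite /ball /= distrC; apply: lt_le_trans h _.
  by rewrite ge_min lexx.
have -> : cos (t - t0) = cos `|t - t0|.
  by case: (ger0P (t - t0)) => // _; rewrite cosN.
have xle : `|t - t0| <= 2 * pi - 1 by rewrite ler_norml; apply/andP; split; lra.
move: `|t - t0| tr xle => x tr xle.
suff : cos x <= cos r' by lra.
have [xpi|xpi] := leP x pi.
  by rewrite leNgt ltr_cos ?in_itv /= -?leNgt//; apply/andP; split; lra.
have -> : cos x = cos (2 * pi - x).
  by rewrite -[RHS]cosN opprB -[LHS](cosD2pi_int _ (-1)); congr cos; rewrite mulrNz mulr1z; ring.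
by rewrite leNgt ltr_cos ?in_itv /= -?leNgt//; first lra; apply/andP; split; lra.
Qed.

(* With [q] the coefficients of the quotient by [cis (t - t0) - 1], the
   symmetric partial sum at [t0] telescopes to two boundary terms. *)
Lemma null_at (c : int -> R[i]) (cc : R -> R[i]) t0 j :
  (forall n, c n = cc (- n%:~R)) ->
  (forall nu j, normc (cc nu - coef (fun=> 1) j nu) <= 4 * (e * 1) * 2^-1 ^+ j) ->
  t0 \in `[0, 2 * pi] -> ~ sset (s j) t0 -> sym_partial_sums_to0 c t0.
Proof.
move=> hc hcc t0I nK; have [de de0 far] := stage_far t0I nK.
have [g' [K [g1 g2 g3 g4]]] := recip_C1 t0 de0.
pose g := recip t0 de.
have hg : C1bound g K by exists g'; split => t _.
have K0 := C1bound_ge0 hg.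
have [q hq] := coef_limit hg; have q0 := coef_limit_to0 hg hq.
(* At each [t] either the stage vanishes or [g] inverts e^(i(t - t0)) - 1. Inserting the product of
   the two makes the coefficient a twisted difference of those weighted by [g]. *)
have rel i nu : (j <= i)%N ->
    coef (fun=> 1) i nu = cis (- t0) * coef g i (nu + 1) - coef g i nu.
  move=> ji; rewrite /coef -cintZ; last by move=> t It; exact: ccont_coef hg It.
  rewrite -cintB.
  - apply: eq_cint => t It.
    have -> : osc 0 (nu + 1) 0 t = osc 0 nu 0 t * cis t.
      by rewrite /osc -cisD; congr cis; ring.
    have -> : cis (- t0) * (sfun (s i) t * g t * (osc 0 nu 0 t * cis t)) -
        sfun (s i) t * g t * osc 0 nu 0 t =
        sfun (s i) t * osc 0 nu 0 t * (g t * (cis t * cis (- t0) - 1)) by ring.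
    rewrite -cisD; have [->|h] := far i t ji; first by rewrite !mul0r.
    by rewrite recip_mul// !mulr1.
  - move=> t It; apply: ccontM; first exact: ccont_cst.
    exact: ccont_coef hg It.
  - by move=> t It; exact: ccont_coef hg It.
(* The same relation in the limit: all three approximations have geometric error. *)
have cq nu : cc nu = cis (- t0) * q (nu + 1) - q nu.
  apply/eqP; rewrite -subr_eq0; apply/eqP/Normc.eq0_normc/eqP.
  rewrite eq_le normc_ge0 andbT.
  have h0 : 0 <= 4 * (e * 1) + 4 * (e * K) + 4 * (e * K) by rewrite !addr_ge0 ?mulr_ge0// ltW.
  apply: (@geometric_small _ _ _ _ j h0) => i ji; rewrite addr0.
  have -> : cc nu - (cis (- t0) * q (nu + 1) - q nu) =
    (cc nu - coef (fun=> 1) i nu) - cis (- t0) * (q (nu + 1) - coef g i (nu + 1)) +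
    (q nu - coef g i nu) by rewrite rel//; ring.
  apply: le_trans (ler_normcD _ _) _; rewrite 2!mulrDl.
  apply: lerD; last exact: hq.
  apply: le_trans (ler_normcB _ _) _; apply: lerD; first exact: hcc.
  by rewrite Normc.normcM normc_cis mul1r; exact: hq.
(* The term of index [n] at [t0] is [G (n - 1) - G n], so the sum over |n| <= N leaves the indices
   [- N - 1] and [N]. *)
pose G (n : int) : R[i] := cis (n%:~R * t0) * q (- n%:~R).
have SN N : sym_partial_sum c N t0 = G (- N%:Z - 1) - G N%:Z.
  rewrite /sym_partial_sum.
  rewrite (eq_bigr (fun k : nat => (- G (k.+1%:Z - N%:Z - 1)) - (- G (k%:Z - N%:Z - 1)))).
    rewrite telescope_sumr//; rewrite opprK addrC; congr (_ - _).
      by rewrite sub0r.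
    by congr G; rewrite -addnn; lia.
  move=> k _; have -> : k.+1%:Z - N%:Z - 1 = k%:Z - N%:Z by lia.
  move: (k%:Z - N%:Z) => n; rewrite hc cq /G /expint -/(cis _).
  have -> : - (n - 1)%:~R = - n%:~R + 1 :> R by rewrite intrB; ring.
  have -> : cis ((n - 1)%:~R * t0) = cis (n%:~R * t0) * cis (- t0).
    by rewrite -cisD; congr cis; rewrite intrB; ring.
  by rewrite opprK; ring.
have S0 eta : 0 < eta -> \forall N \near \oo, normc (sym_partial_sum c N t0) <= eta.
  move=> eta0; have eta2 : 0 < eta / 2 by rewrite divr_gt0.
  have [B HB] := q0 _ eta2.
  exists (Num.bound B) => // N /= BN.
  have BNR : B <= N%:R.
    apply: (@le_trans _ _ (Num.bound B)%:R); last by rewrite ler_nat.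
    by apply: ltW; apply: le_lt_trans (ler_norm B) _; exact: unstable.ltr_norm_bound.
  rewrite SN; apply: le_trans (ler_normcB _ _) _; rewrite [leRHS]splitr.
  rewrite /G !Normc.normcM !normc_cis !mul1r; apply: lerD; apply: HB.
    rewrite intrB mulrNz opprB opprK -pmulrn mulr1z ger0_norm ?addr_ge0//.
    by rewrite (le_trans BNR)// lerDr.
  by rewrite normrN -pmulrn ger0_norm.
split; apply/cvgrPdist_le => eta eta0; have := S0 eta eta0; apply: filterS => N hN;
  rewrite sub0r normrN.
- exact: le_trans (normr_Re_le _) hN.
- exact: le_trans (normr_Im_le _) hN.
Qed.

Lemma negligible_alive : mu.-negligible (\bigcap_j sset (s j)).
Proof.
have cl j : closed (sset (s j)) by have [] := s_ok j.
have ms j : measurable (sset (s j)) by exact: closed_measurable.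
have mI : measurable (\bigcap_j sset (s j)) by exact: bigcapT_measurable.
exists (\bigcap_j sset (s j)); split => //.
have sub j : \bigcap_j sset (s j) `<=` sset (s j) by move=> t /(_ j); exact.
have fin j : mu (sset (s j)) \is a fin_num.
  rewrite ge0_fin_numE//; apply: measure_sub12_fin => //.
  by have [] := s_ok j.
apply/eqP; rewrite eq_le measure_ge0 andbT.
apply/lee_addgt0Pr => eta eta0; rewrite add0e.
have [_ _ _ _ h] := s_ok (Num.bound (127 / eta)).
set j := Num.bound _ in h.
apply: (@le_trans _ _ (mu (sset (s j)))).
  apply: le_measure; [rewrite inE; exact: mI|rewrite inE; exact: ms|exact: sub].
rewrite -(fineK (fin j)) lee_fin; apply: (le_trans h).
have : 127 / eta < j%:R by apply: archi_boundP; rewrite divr_ge0// ltW.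
rewrite ltr_pdivrMr// => h1; rewrite ler_pdivrMr; last by rewrite ltr_wpDl.
nra.
Qed.

End NullSeries.

(** * Nontriviality and conclusion *)

(** Where |t - 3/2| <= 3/8, both arguments of [flat] are at least 1/8 and the bump is at least [c];
    elsewhere the parabola [g] is negative. So [g] is a minorant, with explicit integral c (9/64 -
    1/12) > 0. *)
Lemma Rintegral_bump_gt0 {R : realType} :
  0 < \int[@lebesgue_measure R]_(t in `[1, 2]) (bump 0 0 t : R).
Proof.
pose c : R := flat 0 (1 / 8) * flat 0 (1 / 8).
have f0 : 0 < flat 0 (1 / 8) :> R by apply: flat_gt0; lra.
have c0 : 0 < c by exact: mulr_gt0.
pose g (t : R) := c * (9 / 64 - (t - 3 / 2) * (t - 3 / 2)).
pose G (t : R) := c * (9 / 64 * t - (t - 3 / 2) ^+ 3 / 3).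
have dt (t : R) : is_derive t (1 : R) (fun x => x - 3 / 2) 1.
  have H := is_deriveB (is_derive_id t (1 : R)) (is_derive_cst (3 / 2 : R) t (1 : R)).
  by apply: (is_derive_eq H); rewrite subr0.
have cg t : continuous_at t g.
  have c1 := is_derive_cont (dt t).
  apply: cont_atM; first exact: cont_at_cst.
  apply: cont_atD; first exact: cont_at_cst.
  exact: (continuousN (cont_atM c1 c1)).
apply: (@lt_le_trans _ _ (\int[@lebesgue_measure R]_(t in `[1, 2]) g t)); last first.
  apply: le_Rintegral => //.
  - by apply: integrable12 => t _; exact: cg.
  - by apply: integrable12 => t _; exact: is_derive_cont (is_derive_bump 0 0 t).
  move=> t; rewrite /= in_itv /= => /andP[t1 t2].
  have [h|h] := leP ((t - 3 / 2) * (t - 3 / 2)) (9 / 64); last first.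
    apply: (@le_trans _ _ 0); last by rewrite mulr_ge0 ?flat_ge0.
    by rewrite /g pmulr_rle0//; lra.
  apply: (@le_trans _ _ c).
    by rewrite /g ler_piMr ?(ltW c0)//; have := sqr_ge0 (t - 3 / 2); nra.
  by apply: ler_pM; rewrite ?flat_ge0//; apply: flat0_homo; nra.
have -> : \int[@lebesgue_measure R]_(t in `[1, 2]) g t = G 2 - G 1.
  apply: (@Rintegral12_FTC _ g G) => t _; last exact: cg.
  have H1 := is_deriveM (is_derive_cst (9 / 64 : R) t (1 : R)) (is_derive_id t (1 : R)).
  have H2 := is_deriveM (is_deriveX 3 (dt t)) (is_derive_cst (3^-1 : R) t (1 : R)).
  have H := is_deriveM (is_derive_cst c t (1 : R)) (is_deriveB H1 H2).
  by apply: (is_derive_eq H); rewrite /g /GRing.scale /=; field.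
by rewrite /G; nra.
Qed.

Theorem theorem1 (R : realType) :
  exists c : int -> R[i],
    (exists n : int, c n != 0) /\
    {ae (@lebesgue_measure R), forall t : R,
        t \in `[0, 2 * pi] -> sym_partial_sums_to0 c t} /\
    (forall k : nat, (1 <= k)%N ->
       exists (C : R) (M : nat), forall n : nat, (M <= n)%N ->
         Normc.normc (c (- n%:Z)) <= C / (n%:R ^+ k)).
Proof.
pose I0 : R := \int[@lebesgue_measure R]_(t in `[1, 2]) bump 0 0 t.
have I00 : 0 < I0 by exact: Rintegral_bump_gt0.
(* The limit coefficient at 0 differs from [I0] by at most four times this number, that is [I0 / 2],
   and so cannot vanish. *)
have e0 : 0 < I0 / 8 by rewrite divr_gt0.
have [s [s0 s_ok s_next]] := stage_sequence e0.
have [cc hcc] := coef_limit s_ok s_next (@C1bound1 R).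
(* Index [n] corresponds to [nu = - n], so negative indices fall in the range [0 < nu] of
   [coef_limit_decay]. *)
exists (fun n => cc (- n%:~R)); split; last split.
- exists 0; apply/negP => /eqP c0.
  have := hcc 0 0%N; rewrite -[X in cc X]oppr0 -[X in cc (- X)]/((0 : int)%:~R) c0 sub0r normcN.
  rewrite /coef s0 expr0 !mulr1 => h.
  have : I0 <= 4 * (I0 / 8).
    apply: le_trans h; apply: le_trans (normr_Re_le _); apply: le_trans (ler_norm _).
    rewrite le_eqVlt; apply/orP; left; apply/eqP; apply: eq_Rintegral => t _.
    by rewrite /osc !mul0r !addr0 cis0 !mulr1.
  lra.
- move: (negligible_alive s_ok); apply: negligibleS => t /=.
  (* By [null_at], an exceptional point belongs to every [sset (s j)]. *)
  move=> /not_implyP[tI nt] j _; apply: contrapT => nK; apply: nt.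
  exact: (null_at e0 s_ok s_next (fun n => erefl) hcc tI nK).
- move=> k _; have [C C0 HC] := coef_limit_decay e0 s_ok s_next k hcc.
  exists C, 1%N => n n1; rewrite mulrNz opprK -pmulrn.
  by apply: HC; rewrite ltr0n.
Qed.
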